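(* Let $d,m\ge1$ and let $K\subseteq\mathbb{R}^d$ be the self-similar set generated by an iterated function system $\{f_i\}_{i=1}^m$ of contractive similitudes on $\mathbb{R}^d$, and let $U$ be its univoque set. Suppose that $\{f_i\}_{i=1}^m$ is of general finite type. Then $\{f_i\}_{i=1}^m$ satisfies the open set condition if and only if $\dim_H U=\dim_S K$.
   Context: IFS and self-similar set. $\Omega=\{1,\dots,m\}$ and $f_i(x)=r_iR_ix+b_i$ for $i\in\Omega$, where $0<r_i<1$, $R_i$ is an orthogonal transformation of $\mathbb{R}^d$ and $b_i\in\mathbb{R}^d$. The self-similar set $K$ is the unique nonempty compact set with $K=\bigcup_{i=1}^m f_i(K)$. The similarity dimension $\dim_S K$ is the unique solution $s$ of $\sum_{j=1}^m r_j^s=1$. $\dim_H$ is Hausdorff dimension, with $\dim_H\emptyset=0$. Univoque set. A coding of $x\in K$ is a sequence $(i_n)_{n\ge1}\in\Omega^{\mathbb{N}}$ with $x=\lim_{n\to\infty}f_{i_1}\circ\cdots\circ f_{i_n}(0)$. $U$ is the set of $x\in K$ having exactly one coding. Open set condition. $\{f_i\}_{i=1}^m$ satisfies the open set condition if there is a nonempty bounded open set $W\subseteq\mathbb{R}^d$ such that $f_i(W)\subseteq W$ for all $i$ and the sets $f_i(W)$, $1\le i\le m$, are pairwise disjoint. General finite type (the generalized finite type condition of Lau and Ngai). Let $\Sigma^*=\bigcup_{k\ge0}\Omega^k$ be the set of finite words including the empty word $\varnothing$. For $\mathbf{i}=i_1\cdots i_k$ put $f_{\mathbf{i}}=f_{i_1}\circ\cdots\circ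 f_{i_k}$, $f_\varnothing=\mathrm{id}$, and let $|\mathbf{i}|$ be the length of $\mathbf{i}$. Write $\mathbf{i}\preceq\mathbf{j}$ if $\mathbf{i}$ is an initial segment of $\mathbf{j}$ (including $\mathbf i=\mathbf j$). A sequence $\{\mathcal{M}_k\}_{k\ge0}$ of finite nonempty subsets of $\Sigma^*$ with $\mathcal{M}_0=\{\varnothing\}$ is a sequence of nested index sets if, with $\underline m_k=\min\{|\mathbf{i}|:\mathbf{i}\in\mathcal{M}_k\}$ and $\overline m_k=\max\{|\mathbf{i}|:\mathbf{i}\in\mathcal{M}_k\}$: (1) $(\underline m_k)$ and $(\overline m_k)$ are nondecreasing and both tend to $\infty$; (2) each $\mathcal{M}_k$ is an antichain for $\preceq$; (3) for every $\mathbf{j}\in\Sigma^*$ with $|\mathbf{j}|>\overline m_k$ or $\mathbf{j}\in\mathcal{M}_{k+1}$ there is $\mathbf{i}\in\mathcal{M}_k$ with $\mathbf{i}\preceq\mathbf{j}$; (4) for every $\mathbf{j}\in\Sigma^*$ with $|\mathbf{j}|<\underline m_k$, or $\mathbf{j}\in\mathcal{M}_{k-1}$ (when $k\ge1$), there is $\mathbf{i}\in\mathcal{M}_k$ with $\mathbf{j}\preceq\mathbf{i}$; (5) there is a positive integer $L$, independent of $k$, such that $|\mathbf{j}|-|\mathbf{i}|\le L$ whenever $\mathbf{i}\in\mathcal{M}_k$, $\mathbf{j}\in\mathcal{M}_{k+1}$ and $\mathbf{i}\preceq\mathbf{j}$. The level-$k$ vertices are the pairs $\mathcal{V}_k=\{(f_{\mathbf{i}},k):\mathbf{i}\in\mathcal{M}_k\}$,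 so words giving the same map at the same level give the same vertex. Put $\mathcal{V}=\bigcup_{k\ge0}\mathcal{V}_k$, and for $v=(f_{\mathbf{i}},k)$ write $f_v=f_{\mathbf{i}}$. Let $O\subseteq\mathbb{R}^d$ be a nonempty bounded open set that is invariant, i.e. $\bigcup_{i=1}^m f_i(O)\subseteq O$. Vertices $v,v'\in\mathcal{V}_k$ of the same level are neighbors if $f_v(O)\cap f_{v'}(O)\ne\emptyset$, and $N(v)=\{v'\in\mathcal{V}_k: v'\text{ is a neighbor of }v\}$ (so $v\in N(v)$). For $v\in\mathcal{V}_k$ and $v'\in\mathcal{V}_{k'}$ write $v\sim v'$ if, with $\tau=f_{v'}\circ f_v^{-1}$: (i) $\{f_{u'}:u'\in N(v')\}=\{\tau\circ f_u:u\in N(v)\}$; and (ii) whenever $u\in N(v)$ and $u'\in N(v')$ satisfy $f_{u'}=\tau\circ f_u$, then for every integer $\ell\ge1$ and every $\mathbf{i}\in\Sigma^*$, $(f_u\circ f_{\mathbf{i}},k+\ell)\in\mathcal{V}_{k+\ell}$ if and only if $(f_{u'}\circ f_{\mathbf{i}},k'+\ell)\in\mathcal{V}_{k'+\ell}$. This is an equivalence relation on $\mathcal{V}$. The IFS is of general finite type if there exist a sequence of nested index sets $\{\mathcal{M}_k\}_{k\ge0}$ and a nonempty bounded invariant open set $O$ such that $\mathcal{V}/\!\sim$ is finite. *)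

(* Defs.v *)
From mathcomp Require Import all_boot all_order all_algebra finmap.
From mathcomp Require Import all_classical all_reals all_analysis.

Set Implicit Arguments.
Unset Strict Implicit.
Unset Printing Implicit Defensive.

Import Order.TTheory GRing.Theory Num.Theory.
Import numFieldNormedType.Exports.

Local Open Scope classical_set_scope.
Local Open Scope ring_scope.

(* The library topology and [bounded_set] on 'cV[R]_d come from the sup norm,
   which is equivalent to the Euclidean one. The Euclidean norm is used wherever
   distances are measured, i.e. for diameters. *)

Definition enorm (R : realType) (d : nat) (x : 'cV[R]_d) : R :=
  Num.sqrt (\sum_(i < d) x i 0 ^+ 2).

(* diam set0 = -oo *)
Definition diam (R : realType) (d : nat) (A : set 'cV[R]_d) : \bar R :=
  ereal_sup [set (enorm (xy.1 - xy.2))%:E | xy in A `*` A].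

(* |A|^s with the conventions |set0|^s = 0 and 0^0 = 1 *)
Definition diam_pow (R : realType) (d : nat) (s : R) (A : set 'cV[R]_d) :
    \bar R :=
  if A == set0 then 0%E else poweR (diam A) s.

Definition hausdorff_pre (R : realType) (d : nat) (s delta : R)
    (X : set 'cV[R]_d) : \bar R :=
  ereal_inf [set (\sum_(0 <= n <oo) diam_pow s (A n))%E |
    A in [set A : nat -> set 'cV[R]_d |
            X `<=` \bigcup_n A n /\ forall n, (diam (A n) <= delta%:E)%E]].

Definition hausdorff_measure (R : realType) (d : nat) (s : R)
    (X : set 'cV[R]_d) : \bar R :=
  ereal_sup [set hausdorff_pre s delta X | delta in [set delta | 0 < delta]].

Definition hausdorff_dim (R : realType) (d : nat) (X : set 'cV[R]_d) : \bar R :=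
  ereal_inf [set s%:E | s in [set s : R | 0 <= s /\ hausdorff_measure s X = 0%E]].

Record simIFS (R : realType) (d m : nat) := SimIFS {
  ratio : 'I_m -> R;
  rot : 'I_m -> 'M[R]_d;
  shift : 'I_m -> 'cV[R]_d;
  ratio_itv : forall i, 0 < ratio i < 1;
  rot_orthogonal : forall i, rot i *m (rot i)^T = 1%:M
}.

Section IFS.
Variables (R : realType) (d m : nat) (F : simIFS R d m).

Local Notation E := 'cV[R]_d.

Definition ifs_map (i : 'I_m) (x : E) : E :=
  ratio F i *: (rot F i *m x) + shift F i.

Definition self_similar_set (K : set E) : Prop :=
  [/\ K !=set0, compact K & K = \bigcup_i (ifs_map i @` K)].

(* the sum is strictly decreasing in s, so for 1 <= m there is exactly one
   solution and the default 0 is not used *)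
Definition sim_dim : R := xget 0 [set s : R | \sum_(i < m) ratio F i `^ s = 1].

Definition word_map (w : seq 'I_m) : E -> E :=
  foldr (fun i g => ifs_map i \o g) id w.

Definition is_coding (x : E) (c : nat -> 'I_m) : Prop :=
  word_map (mkseq c n) 0 @[n --> \oo] --> x.

Definition univoque_set (K : set E) : set E :=
  [set x | K x /\ exists! c : nat -> 'I_m, is_coding x c].

Definition open_set_condition : Prop :=
  exists W : set E,
    [/\ W !=set0, bounded_set W, open W,
        forall i, ifs_map i @` W `<=` W
      & trivIset setT (fun i => ifs_map i @` W)].

Definition max_len (M : {fset seq 'I_m}) : nat := \max_(w <- M) size w.

(* for nonempty M the idle bound [max_len M] is harmless: this is the minimal
   length of a word of M *)
Definition min_len (M : {fset seq 'I_m}) : nat :=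
  \big[minn/max_len M]_(w <- M) size w.

Record nested_index_sets (M : nat -> {fset seq 'I_m}) : Prop := {
  nested_nonempty : forall k, M k != fset0;
  nested_init : M 0%N = [fset [::]]%fset;
  nested_min_homo : {homo (fun k => min_len (M k)) : k l / (k <= l)%N};
  nested_max_homo : {homo (fun k => max_len (M k)) : k l / (k <= l)%N};
  nested_min_infty : min_len (M k) @[k --> \oo] --> \oo;
  nested_max_infty : max_len (M k) @[k --> \oo] --> \oo;
  nested_antichain : forall k u v,
    u \in M k -> v \in M k -> prefix u v -> u = v;
  nested_above : forall k v, (max_len (M k) < size v)%N \/ v \in M k.+1 ->
    exists2 u, u \in M k & prefix u v;
  nested_below : forall k v,
    (size v < min_len (M k))%N \/ ((1 <= k)%N /\ v \in M k.-1) ->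
    exists2 u, u \in M k & prefix v u;
  nested_gap : exists2 L : nat, (0 < L)%N & forall k u v,
    u \in M k -> v \in M k.+1 -> prefix u v -> (size v - size u <= L)%N
}.

Definition invariant_open_set (O : set E) : Prop :=
  [/\ O !=set0, bounded_set O, open O & \bigcup_i (ifs_map i @` O) `<=` O].

Definition vertex : Type := ((E -> E) * nat)%type.

Section Vertices.
Variables (M : nat -> {fset seq 'I_m}) (O : set E).

Definition vertices_at (k : nat) : set vertex :=
  [set (word_map w, k) | w in [set` M k]].

Definition vertices : set vertex := \bigcup_k vertices_at k.

Definition neighborhood (v : vertex) : set vertex :=
  [set u | vertices_at v.2 u /\ (v.1 @` O) `&` (u.1 @` O) !=set0].

(* f_{v'} \o f_v^-1 *)
Definition transfer (v v' : vertex) : E -> E :=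
  v'.1 \o 'pinv_(fun=> 0) setT v.1.

Definition vertex_equiv (v v' : vertex) : Prop :=
  [set u'.1 | u' in neighborhood v'] =
    [set transfer v v' \o u.1 | u in neighborhood v] /\
  forall u u', neighborhood v u -> neighborhood v' u' ->
    u'.1 = transfer v v' \o u.1 ->
    forall (l : nat) (w : seq 'I_m), (1 <= l)%N ->
      vertices_at (v.2 + l) (u.1 \o word_map w, (v.2 + l)%N) <->
      vertices_at (v'.2 + l) (u'.1 \o word_map w, (v'.2 + l)%N).

Definition vertex_classes : set (set vertex) :=
  [set [set v' | vertices v' /\ vertex_equiv v v'] | v in vertices].

End Vertices.

Definition general_finite_type : Prop :=
  exists (M : nat -> {fset seq 'I_m}) (O : set E),
    [/\ nested_index_sets M, invariant_open_set O
      & finite_set (vertex_classes M O)].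

End IFS.

(* Main.v *)
(* Schief's argument: let B be bounded with f_i(B) in B, and call v a neighbour of w if r_v is
   comparable to r_w and f_v(B) meets f_w(B). If the number of neighbours is bounded, choose w with
   the most neighbours; then the neighbours of k w are just the k v with v a neighbour of w, so
   f_{kw}(B) is disjoint from every f_j(B) for which j and k start with different letters.

   If the open set condition holds, its disjoint open sets bound the number of neighbours. Taking
   for B the 1-neighbourhood of K gives a word w such that every coding containing w infinitely
   often is univoque, and such that the subsystem {f_{uw} : |u| = n} is separated by a gap. Its
   dimension tends to dim_S K as n grows.

   Conversely, if two distinct words w, w' of some M_k give the same map, no univoque coding
   contains w, which forces dim_H U < dim_S K. If there are no such words, the finiteness of the
   number of vertex types bounds how often the sets f_v(O), with r_v comparable to a given r, can
   overlap at a point. So the number of neighbours with respect to B = O is bounded, and the union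
   over k of f_{kw}(O) witnesses the open set condition. *)

From mathcomp Require Import all_boot all_order all_algebra finmap.
From mathcomp Require Import all_classical all_reals all_analysis.
From mathcomp Require Import ring lra.
Require Import Defs.

Set Implicit Arguments.
Unset Strict Implicit.
Unset Printing Implicit Defensive.

Import Order.TTheory GRing.Theory Num.Theory.
Import numFieldNormedType.Exports.

Local Open Scope classical_set_scope.
Local Open Scope ring_scope.

(** * Norms and words *)

Section EuclideanNorm.
Variables (R : realType) (d : nat).
Implicit Types x : 'cV[R]_d.

Lemma coord_le_norm x i : `|x i 0| <= `|x|.
Proof.
have -> : `|x| = mx_norm x by [].
by rewrite mx_normrE; apply: (le_bigmax _ (fun ij => `|x ij.1 ij.2|) (i, 0)).
Qed.

Lemma norm_le_enorm x : `|x| <= enorm x.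
Proof.
have -> : `|x| = mx_norm x by [].
rewrite mx_normrE; apply/bigmax_leP; split=> [|[i j] _] /=; first exact: sqrtr_ge0.
rewrite ord1 -sqrtr_sqr ler_sqrt ?sqr_ge0 //.
  by rewrite (bigD1 i) //= lerDl sumr_ge0 // => k _; exact: sqr_ge0.
by rewrite sumr_ge0 // => k _; exact: sqr_ge0.
Qed.

Lemma enorm_le_norm x : enorm x <= d%:R * `|x|.
Proof.
rewrite -[leRHS]ger0_norm ?mulr_ge0 // -sqrtr_sqr ler_sqrt ?sqr_ge0 //.
have : \sum_(i < d) x i 0 ^+ 2 <= \sum_(i < d) `|x| ^+ 2.
  by apply: ler_sum => i _; rewrite -real_normK ?num_real // lerXn2r ?nnegrE ?coord_le_norm.
rewrite sumr_const card_ord -[_ *+ d]mulr_natl => /le_trans; apply.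
rewrite exprMn ler_wpM2r ?sqr_ge0 // -natrX ler_nat.
by case: (d) => // n; rewrite leq_pmulr.
Qed.

Lemma enorm_ge0 x : 0 <= enorm x.
Proof. exact: sqrtr_ge0. Qed.

Lemma enorm_eq0 x : enorm x = 0 -> x = 0.
Proof.
by move=> x0; apply/normr0_eq0/le_anti; rewrite normr_ge0 -x0 norm_le_enorm.
Qed.

Lemma enorm0 : enorm (0 : 'cV[R]_d) = 0.
Proof. by rewrite /enorm big1 ?sqrtr0 // => i _; rewrite mxE expr0n. Qed.

Lemma enormZ a x : 0 <= a -> enorm (a *: x) = a * enorm x.
Proof.
move=> a0; rewrite /enorm.
under eq_bigr do rewrite mxE exprMn.
by rewrite -mulr_sumr sqrtrM ?sqr_ge0 // sqrtr_sqr ger0_norm.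
Qed.

Lemma enorm_orthogonal (Q : 'M[R]_d) x : Q *m Q^T = 1%:M -> enorm (Q *m x) = enorm x.
Proof.
have dot (y : 'cV[R]_d) : \sum_(i < d) y i 0 ^+ 2 = (y^T *m y) 0 0.
  by rewrite mxE; apply: eq_bigr => i _; rewrite mxE expr2.
move=> /mulmx1C Q1.
by rewrite /enorm !dot trmx_mul mulmxA -(mulmxA x^T) Q1 mulmx1.
Qed.

End EuclideanNorm.

Section Words.
Variables (R : realType) (d m : nat) (F : simIFS R d m).
Implicit Types (u v w : seq 'I_m) (x y : 'cV[R]_d).

Definition word_ratio w : R := \prod_(i <- w) ratio F i.

Lemma word_ratio_nil : word_ratio [::] = 1.
Proof. exact: big_nil. Qed.

Lemma word_ratio_cat u v : word_ratio (u ++ v) = word_ratio u * word_ratio v.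
Proof. exact: big_cat. Qed.

Lemma ratio_gt0 i : 0 < ratio F i.
Proof. by case/andP: (ratio_itv F i). Qed.

Lemma ratio_lt1 i : ratio F i < 1.
Proof. by case/andP: (ratio_itv F i). Qed.

Lemma word_ratio_gt0 w : 0 < word_ratio w.
Proof. by apply: prodr_gt0 => i _; exact: ratio_gt0. Qed.

Lemma word_ratio_le1 w : word_ratio w <= 1.
Proof.
elim: w => [|i w IH]; first by rewrite word_ratio_nil.
by rewrite /word_ratio big_cons mulr_ile1 ?(ltW (ratio_gt0 _))
  ?(ltW (ratio_lt1 _)) ?(ltW (word_ratio_gt0 _)).
Qed.

Lemma word_ratio_lt1 w : w != [::] -> word_ratio w < 1.
Proof.
case: w => // i w _; rewrite /word_ratio big_cons.
apply: le_lt_trans (ratio_lt1 i).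
by rewrite ler_piMr ?word_ratio_le1 // ltW ?ratio_gt0.
Qed.

Lemma ratio_lower : exists2 c : R, 0 < c <= 1 & forall w, c ^+ size w <= word_ratio w.
Proof.
(* Starting the minimum at 1 keeps [c <= 1] even over an empty alphabet. *)
have c0 : 0 < \big[Num.min/1]_i ratio F i.
  by apply/bigmin_gtP; split=> // i _; exact: ratio_gt0.
exists (\big[Num.min/1]_i ratio F i); first by rewrite c0 bigmin_le_id.
elim=> [|i w IH]; first by rewrite word_ratio_nil expr0.
by rewrite exprS /word_ratio big_cons ler_pM ?bigmin_le ?exprn_ge0 ?(ltW c0).
Qed.

Lemma ratio_upper : exists2 c : R, 0 <= c < 1 & forall w, word_ratio w <= c ^+ size w.
Proof.
have c0 : 0 <= \big[Num.max/0]_i ratio F i by exact: bigmax_ge_id.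
exists (\big[Num.max/0]_i ratio F i).
  by rewrite c0 bigmax_lt // => i _; exact: ratio_lt1.
elim=> [|i w IH]; first by rewrite word_ratio_nil expr0.
rewrite exprS /word_ratio big_cons ler_pM ?(ltW (word_ratio_gt0 _)) ?(ltW (ratio_gt0 _)) //.
exact: le_bigmax.
Qed.

Lemma word_map_cat u v : word_map F (u ++ v) = word_map F u \o word_map F v.
Proof. by elim: u => //= i u ->. Qed.

Lemma enorm_word_map w x y :
  enorm (word_map F w x - word_map F w y) = word_ratio w * enorm (x - y).
Proof.
elim: w => [|i w IH] /=; first by rewrite word_ratio_nil mul1r.
rewrite /word_ratio big_cons -mulrA -/(word_ratio w) -IH /ifs_map.
rewrite opprD addrACA subrr addr0 -scalerBr -mulmxBr enormZ ?(ltW (ratio_gt0 _)) //.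
by rewrite enorm_orthogonal // rot_orthogonal.
Qed.

Lemma word_map_inj w : injective (word_map F w).
Proof.
move=> x y fxy; have /esym/eqP := enorm_word_map w x y.
rewrite fxy subrr enorm0 mulf_eq0 gt_eqF ?word_ratio_gt0 //= => /eqP/enorm_eq0/eqP.
by rewrite subr_eq0 => /eqP.
Qed.

Lemma word_map_surj w x : exists y, word_map F w y = x.
Proof.
elim: w x => [|i w IH] x; first by exists x.
have [y yx] := IH ((rot F i)^T *m ((ratio F i)^-1 *: (x - shift F i))).
exists y => /=; rewrite yx /ifs_map mulmxA rot_orthogonal mul1mx scalerA.
by rewrite divff ?gt_eqF ?ratio_gt0 // scale1r subrK.
Qed.

(* The default of [nth] makes this the concatenation of [w] with the infinite word [e]. *)
Definition cat_stream w (e : nat -> 'I_m) : nat -> 'I_m :=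
  fun i => nth (e (i - size w)%N) w i.

Lemma mkseq_cat_stream w e n : mkseq (cat_stream w e) (size w + n) = w ++ mkseq e n.
Proof.
have x0 := cat_stream w e 0.
apply: (@eq_from_nth _ x0) => [|i]; rewrite size_mkseq ?size_cat ?size_mkseq // => ilt.
rewrite nth_mkseq // nth_cat /cat_stream; case: ltnP => iw; first exact: set_nth_default.
by rewrite nth_default // nth_mkseq // ltn_subLR.
Qed.

Lemma mkseqD (e : nat -> 'I_m) p n :
  mkseq e (p + n) = mkseq e p ++ mkseq (fun i => e (p + i)%N) n.
Proof.
rewrite /mkseq iotaD map_cat add0n; congr (_ ++ _).
by rewrite -{1}[p]addn0 iotaDl -map_comp.
Qed.

End Words.

(** * Neighbours and Schief's argument *)

Lemma truncn_eq_dist (R : realType) (a b : R) : 0 <= a -> 0 <= b ->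
  Num.trunc a = Num.trunc b -> `|a - b| < 1.
Proof.
move=> /truncn_itv /andP[a1 a2] /truncn_itv /andP[b1 b2] ab.
rewrite ab -natr1 in a1 a2; rewrite -natr1 in b2.
by rewrite ltr_norml; apply/andP; split; lra.
Qed.

(** Pigeonhole on a grid: a sup-norm ball of radius [D * t] is cut into cubes of side [delta * t],
    whose number [G] depends on [D], [delta] and [d] but not on the scale [t]. *)
Lemma packing (R : realType) (d : nat) (D delta : R) : 0 < delta ->
  exists G : nat, forall (T : eqType) (g : T -> 'cV[R]_d) c t N (s : seq T),
    0 < t -> uniq s -> {in s, forall v, `|g v - c| <= D * t} ->
    (forall s', uniq s' -> {subset s' <= s} ->
       {in s' &, forall u v, `|g u - g v| < delta * t} -> (size s' <= N)%N) ->
    (size s <= G * N)%N.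
Proof.
move=> delta0; pose n := Num.trunc (2 * D / delta).
exists #|{ffun 'I_d -> 'I_n.+1}| => T g c t N s t0 us sD sN.
(* Offset from the corner of the big cube, measured in cell sides; its integer part is the cell
   index. *)
pose h v i := (g v i 0 - c i 0 + D * t) / (delta * t).
have hE v i : v \in s -> 0 <= h v i <= 2 * D / delta.
  move=> /sD; have := coord_le_norm (g v - c) i; rewrite !mxE => /le_trans /[apply].
  rewrite ler_norml /h => /andP[l u]; apply/andP; split.
    by rewrite divr_ge0 ?mulr_ge0 ?(ltW t0) ?(ltW delta0) //; lra.
  rewrite ler_pdivrMr ?mulr_gt0 //.
  have -> : 2 * D / delta * (delta * t) = 2 * D * t by rewrite mulrA divfK ?gt_eqF.
  lra.
pose cell v := [ffun i => inord (Num.trunc (h v i))] : {ffun 'I_d -> 'I_n.+1}.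
rewrite -(sum1_size s) (partition_big cell predT) //=.
rewrite -sum_nat_const; apply: leq_sum => x _.
rewrite sum1_count -size_filter; apply: sN; first exact: filter_uniq.
  by move=> v; rewrite mem_filter => /andP[].
move=> u v; rewrite !mem_filter => /andP[/eqP ux us'] /andP[/eqP vx vs'].
have dt : 0 < delta * t by rewrite mulr_gt0.
have -> : `|g u - g v| = mx_norm (g u - g v) by [].
rewrite mx_normrE; apply/bigmax_ltP; split=> // -[i j] _ /=; rewrite ord1 !mxE.
have /andP[u0 u1] := hE u i us'; have /andP[v0 v1] := hE v i vs'.
have : Num.trunc (h u i) = Num.trunc (h v i).
  have := congr1 (fun f : {ffun 'I_d -> 'I_n.+1} => nat_of_ord (f i)) (etrans ux (esym vx)).
  by rewrite /= !ffunE !inordK // ltnS le_truncn.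
move=> /(truncn_eq_dist u0 v0); rewrite /h -mulrBl normrM [X in _ * X]gtr0_norm ?invr_gt0 //.
have -> : g u i 0 - c i 0 + D * t - (g v i 0 - c i 0 + D * t) = g u i 0 - g v i 0 by lra.
by rewrite ltr_pdivrMr // mul1r.
Qed.

(** * Words stopped at a given ratio *)

Section Cut.
Variables (R : realType) (d m : nat) (F : simIFS R d m).
Implicit Types (u v w : seq 'I_m) (x y : 'cV[R]_d).
Local Notation f := (word_map F).
Local Notation r := (word_ratio F).

(** The words satisfying this for a fixed [t] form the stopping-time antichain at scale [t]; this
    makes precise that the ratio of [v] is comparable to [t], see [cut_lower]. *)
Definition cut t v := r v <= t /\ forall n, (n < size v)%N -> t < r (take n v).

Lemma cut_prefix t v : r v <= t -> exists2 u, prefix u v & cut t u.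
Proof.
move=> vt; pose P n := r (take n v) <= t.
have exP : exists n, P n by exists (size v); rewrite /P take_size.
case: (ex_minnP exP) => n nt nmin; exists (take n v); first exact: prefix_take.
have nv : (n <= size v)%N by apply: nmin; rewrite /P take_size.
split=> // k; rewrite size_takel // => kn; rewrite take_takel 1?ltnW //.
by rewrite ltNge; apply/negP => /nmin; rewrite leqNgt kn.
Qed.

(** The assumption [t <= 1] keeps the new threshold at most [r k], so no proper prefix of [k] can
    stop early. *)
Lemma cut_cat t k v : cut t v -> t <= 1 -> cut (r k * t) (k ++ v).
Proof.
move=> [vt vn] t1; split=> [|n]; first by rewrite word_ratio_cat ler_wpM2l // ltW ?word_ratio_gt0.
rewrite size_cat => nk; rewrite take_cat; case: ltnP => kn.
  rewrite (@le_lt_trans _ _ (r k)) //; first by rewrite ler_piMr // ltW ?word_ratio_gt0.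
  rewrite -{1}(cat_take_drop n k) word_ratio_cat gtr_pMr ?word_ratio_gt0 // word_ratio_lt1 //.
  by rewrite -size_eq0 size_drop subn_eq0 -ltnNge.
by rewrite word_ratio_cat ltr_pM2l ?word_ratio_gt0 // vn // ltn_subLR.
Qed.

(** Before its last letter the ratio still exceeds [t], and one letter costs at most a factor
    [c]. *)
Lemma cut_lower c t v : (forall w, c ^+ size w <= r w) -> 0 <= c <= 1 -> 0 <= t <= 1 ->
  cut t v -> c * t <= r v.
Proof.
move=> cr /andP[c0 c1] /andP[t0 t1] [_ vt]; case/lastP: v => [|v i] in vt *.
  by rewrite word_ratio_nil mulr_ile1.
rewrite -cats1 word_ratio_cat mulrC ler_pM //; last by have := cr [:: i]; rewrite expr1.
have := vt (size v); rewrite size_rcons ltnSn -cats1 take_size_cat //.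
by move=> /(_ isT)/ltW.
Qed.

End Cut.

(** * Bounded neighbour counts and the maximal word *)

Section Separation.
Variables (R : realType) (d m : nat) (F : simIFS R d m).
Implicit Types (u v w s : seq 'I_m) (x y : 'cV[R]_d) (B O : set 'cV[R]_d).
Local Notation f := (word_map F).
Local Notation r := (word_ratio F).

Lemma word_map_stable B w x : (forall i, ifs_map F i @` B `<=` B) -> B x -> B (f w x).
Proof. by move=> FB Bx; elim: w => //= i w IH; apply: (FB i); exists (f w x). Qed.

Lemma image_word_map_cat B u v : (forall i, ifs_map F i @` B `<=` B) ->
  f (u ++ v) @` B `<=` f u @` B.
Proof.
move=> FB _ [x Bx <-]; rewrite word_map_cat.
by exists (f v x) => //; exact: word_map_stable.
Qed.

Lemma image_word_map_prefix B u v : (forall i, ifs_map F i @` B `<=` B) ->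
  prefix u v -> f v @` B `<=` f u @` B.
Proof. by move=> FB /prefixP[s ->]; exact: image_word_map_cat. Qed.

(** Since [f w] is onto and scales Euclidean distances by exactly [r w], one radius around [y]
    serves for all [w]. *)
Lemma image_word_map_ball O y : open O -> O y -> exists2 rho : R, 0 < rho &
  forall w z, enorm (z - f w y) < rho * r w -> (f w @` O) z.
Proof.
move=> oO Oy; have /nbhs_ballP[rho rho0 yO] : nbhs y O by exact: open_nbhs_nbhs.
exists rho => // w z; have [x <-] := word_map_surj F w z.
rewrite enorm_word_map mulrC ltr_pM2r ?word_ratio_gt0 // => xy.
exists x => //; apply: yO; rewrite -ball_normE /= distrC.
exact: le_lt_trans (norm_le_enorm _) xy.
Qed.

Lemma bounded_setP B : bounded_set B -> exists2 D : R, 0 <= D & forall x, B x -> `|x| <= D.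
Proof.
move=> [M [_ BM]]; exists (`|M| + 1) => [|x Bx]; first by rewrite addr_ge0.
by apply: (BM (`|M| + 1)) => //; rewrite (le_lt_trans (ler_norm M)) // ltrDl.
Qed.

(* Pigeonhole the centres [f v a], [a] in [O]: those falling in one small cell all lie in a
   common [f v @` O]. *)
Lemma cut_neighbors_bounded O B (N1 : nat) : O !=set0 -> open O -> bounded_set B ->
  (forall t z (s : seq (seq 'I_m)), 0 < t <= 1 -> uniq s ->
     {in s, forall v, cut F t v /\ (f v @` O) z} -> (size s <= N1)%N) ->
  exists N : nat, forall w (s : seq (seq 'I_m)), uniq s ->
     {in s, forall v, cut F (r w) v /\ (f v @` B) `&` (f w @` B) !=set0} -> (size s <= N)%N.
Proof.
move=> [a Oa] oO /bounded_setP[D0 D00 BD] mult.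
have [rho rho0 rhoP] := image_word_map_ball oO Oa.
have [c /andP[c0 c1] cP] := ratio_lower F.
pose D1 := d%:R * (D0 + `|a|).
have BD1 b v : B b -> `|f v b - f v a| <= r v * D1.
  move=> Bb; rewrite (le_trans (norm_le_enorm _)) // enorm_word_map.
  rewrite ler_wpM2l ?(ltW (word_ratio_gt0 _ _)) // (le_trans (enorm_le_norm _)) //.
  by rewrite ler_wpM2l // (le_trans (ler_normB _ _)) // lerD2r BD.
pose delta := rho * c / d.+1%:R.
have delta0 : 0 < delta by rewrite divr_gt0 // mulr_gt0.
have [G GP] := @packing R d (D1 + D1) delta delta0.
exists (G * N1)%N => w s us sP.
have rw0 : 0 < r w := word_ratio_gt0 F w.
apply: (GP _ (fun v => f v a) (f w a) (r w)) => //.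
  move=> v /sP[[vw _] [z [[b Bb bz] [b' Bb' bz']]]].
  (* Both centres are compared with the common point [z], which gives the radius [D1 + D1]. *)
  have -> : f v a - f w a = (f w b' - f w a) - (f v b - f v a).
    by rewrite bz bz' opprB [RHS]addrC subrKA.
  rewrite (le_trans (ler_normB _ _)) // mulrDl lerD // ?(le_trans (BD1 _ _ _)) // mulrC //.
  by rewrite ler_wpM2l // mulr_ge0 // addr_ge0.
move=> [//|v0 s'] us' ss sep.
apply: (mult (r w) (f v0 a)) => //; first by rewrite rw0 word_ratio_le1.
move=> v vs; have [vw _] := sP v (ss v vs); split=> //.
apply: rhoP; have /ltW v0v := sep v0 v (mem_head _ _) vs.
apply: le_lt_trans (enorm_le_norm _) _; apply: le_lt_trans (ler_wpM2l _ v0v) _ => //.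
have crv : c * r w <= r v by apply: cut_lower vw; rewrite ?(ltW c0) // (ltW rw0) word_ratio_le1.
apply: (@lt_le_trans _ _ (rho * (c * r w))); last by rewrite ler_wpM2l // ltW.
rewrite 2!mulrA ltr_pM2r // /delta mulrCA gtr_pMr ?mulr_gt0 //.
by rewrite ltr_pdivrMr // mul1r ltr_nat.
Qed.

(** Prefixing [l :: k] to a largest family of neighbours of [w] yields a family for [l :: k ++ w]
    that is again largest, so every neighbour of that word begins with [l]. *)
Lemma separating_word B (N : nat) : (forall i, ifs_map F i @` B `<=` B) ->
  (forall w (s : seq (seq 'I_m)), uniq s ->
     {in s, forall v, cut F (r w) v /\ (f v @` B) `&` (f w @` B) !=set0} -> (size s <= N)%N) ->
  exists w, forall l k l' j, l != l' -> r (l' :: j) <= r (l :: k ++ w) ->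
    (f (l' :: j) @` B) `&` (f (l :: k ++ w) @` B) = set0.
Proof.
move=> FB bounded.
pose nbr w v := cut F (r w) v /\ (f v @` B) `&` (f w @` B) !=set0.
pose P n := `[< exists w (s : seq (seq 'I_m)),
  [/\ uniq s, {in s, forall v, nbr w v} & size s = n] >].
have exP : exists n, P n by exists 0%N; apply/asboolP; exists [::], [::].
have PN n : P n -> (n <= N)%N by move=> /asboolP[w [s [us sP <-]]]; exact: bounded us sP.
case: (ex_maxnP exP PN) => n /asboolP[w [s [us sP sn]]] nmax; exists w => l k l' j ll' rj.
rewrite -subset0 => x [xj xk] /=; exfalso.
(* Shortening [l' :: j] to the scale of [l :: k ++ w] only enlarges its image and makes it a genuine
   neighbour. *)
have [v vj vcut] := cut_prefix rj.
have xv : (f v @` B) x by exact: image_word_map_prefix vj _ xj.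
have vk : v \in [seq (l :: k) ++ u | u <- s].
  apply/negP => vs; suff /nmax : P n.+1 by rewrite ltnn.
  apply/asboolP; exists (l :: k ++ w), (v :: [seq (l :: k) ++ u | u <- s]); split.
  - by rewrite /= (introN idP vs) map_inj_uniq // => u1 u2 [] /eqP;
      rewrite eqseq_cat // eqxx => /eqP.
  - move=> u; rewrite inE => /predU1P[->|/mapP[u' /sP[ucut [y [[b Bb by'] [b' Bb' by'']]]] ->]].
      by split=> //; exists x.
    split; first by rewrite -cat_cons word_ratio_cat; apply: cut_cat => //; exact: word_ratio_le1.
    exists (f (l :: k) y); split; first by exists b => //; rewrite word_map_cat /= by'.
    by exists b' => //; rewrite -cat_cons word_map_cat /= by''.
  - by rewrite /= size_map sn.
case/mapP: vk => u _ vu; move: vj; rewrite vu cat_cons prefix_cons => /andP[/eqP ll _].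
by rewrite ll eqxx in ll'.
Qed.

End Separation.
(** * General finite type without exact overlaps *)

Lemma exprn_small (R : realType) (rho e : R) : 0 <= rho < 1 -> 0 < e ->
  exists n, rho ^+ n < e.
Proof.
move=> /andP[r0 r1] e0; have r1' : `|rho| < 1 by rewrite ger0_norm.
have /cvgrPdist_lt/(_ e e0)[n _ /(_ n (leqnn n))] := cvg_expr r1'.
by rewrite /= sub0r normrN ger0_norm ?exprn_ge0 // => ?; exists n.
Qed.

Lemma prefix_total (T : eqType) (u v w : seq T) : prefix u w -> prefix v w ->
  prefix u v || prefix v u.
Proof.
elim: w u v => [|x w IH] [|a u] [|b v] //; rewrite ?prefix0s // !prefix_cons.
by move=> /andP[/eqP-> uw] /andP[/eqP-> vw]; rewrite eqxx IH.
Qed.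

Lemma words_upto (m n : nat) : exists s : seq (seq 'I_m), forall w, (size w <= n)%N -> w \in s.
Proof.
elim: n => [|n [s IH]]; first by exists [:: [::]] => -[].
exists ([::] :: [seq i :: w | i <- enum 'I_m, w <- s]) => -[|i w] // wn.
by rewrite inE /=; apply/allpairsP; exists (i, w); rewrite mem_enum IH.
Qed.

Lemma finite_set_bound (T : Type) (A : set T) (P : T -> nat -> Prop) : finite_set A ->
  (forall x n n', (n <= n')%N -> P x n -> P x n') ->
  (forall x, A x -> exists n, P x n) -> exists n, forall x, A x -> P x n.
Proof.
(* [Pchoice] gives the bare type a choice structure, so that the finite set can be listed. *)
move=> fA mono AP; elim/Pchoice : T => T in A P fA mono AP *.
have /finite_seqP[s sA] := fA.
have {}AP : forall x, x \in s -> exists n, P x n by move=> x xs; apply: AP; rewrite sA.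
suff [n nP] : exists n, forall x, x \in s -> P x n by exists n => x; rewrite sA; exact: nP.
elim: s {sA} AP => [|x s IH] AP; first by exists 0%N.
have [n nP] := IH (fun y ys => AP y (mem_behead (s := x :: s) ys)).
have [n' n'P] := AP x (mem_head x s).
exists (maxn n n') => y; rewrite inE => /predU1P[->|/nP]; first by apply: mono n'P; exact: leq_maxr.
by apply: mono; exact: leq_maxl.
Qed.

Section NestedIndexSets.
Variables (m : nat) (M : nat -> {fset seq 'I_m}).
Hypothesis nestedM : nested_index_sets M.
Implicit Types (u v w : seq 'I_m).

Definition has_index v k := exists2 p, p \in M k & prefix p v.

Lemma has_index0 v : has_index v 0.
Proof. by exists [::]; rewrite ?prefix0s // nested_init // inE. Qed.

Lemma min_len_le k w : w \in M k -> (min_len (M k) <= size w)%N.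
Proof.
rewrite /min_len => wM; have {wM} : w \in enum_fset (M k) by [].
elim: (enum_fset _) => // u s IH; rewrite inE big_cons geq_min => /predU1P[->|/IH ->].
  by rewrite leqnn.
by rewrite orbT.
Qed.

Lemma exists_no_index v : exists k, ~ has_index v k.
Proof.
have [k _ /(_ k (leqnn k))] := nested_min_infty nestedM (nbhs_infty_gt (size v)).
move=> /= vk; exists k => -[p /min_len_le pk /prefixP[s vE]].
by have := leq_trans vk pk; rewrite vE size_cat ltnNge leq_addr.
Qed.

(** Level 0 is reached by every word, and no word reaches all levels because [min_len] tends to
    infinity. The level found lets a whole family of words be compared with one vertex of similar
    size. *)
Lemma last_common_index (s : seq (seq 'I_m)) : s != [::] ->
  exists k, {in s, forall v, has_index v k} /\ exists2 w, w \in s & ~ has_index w k.+1.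
Proof.
move=> s0; apply: contrapT => noK.
have step k : {in s, forall v, has_index v k}.
  elim: k => [|k IH] v vs; first exact: has_index0.
  by apply: contrapT => vk; apply: noK; exists k; split=> //; exists v.
case: s s0 => [//|v s] _ in noK step *.
by have [k] := exists_no_index v; apply; apply: step; exact: mem_head.
Qed.

(** Extend [w] until it must pass level [k.+1], at a word [q]. Then [q] extends [w], and its
    ancestor in [M k] is [p] by the antichain property, so the gap between consecutive levels bounds
    the excess of [w] over [p]. *)
Lemma index_gap : exists L, forall k p w, p \in M k -> prefix p w -> ~ has_index w k.+1 ->
  (size w <= size p + L)%N.
Proof.
have [L _ ML] := nested_gap nestedM; exists L => k p [|i w'] // pM pw wM.
set w := i :: w' in pw wM *.
(* The first letter of [w] is used for padding; the empty word was settled before. *)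
have [|q qM qw] := nested_above nestedM (k := k.+1) (v := w ++ nseq (max_len (M k.+1)).+1 i).
  by left; rewrite size_cat size_nseq ltn_addl.
have {}qw : prefix w q.
  have /orP[//|qw'] := prefix_total (prefix_prefix w _) qw.
  by case: wM; exists q.
have [|p' p'M p'q] := nested_above nestedM (k := k) (v := q); first by right.
have pq := prefix_trans pw qw.
have pE : p = p'.
  have /orP[pp'|pp'] := prefix_total pq p'q.
    exact: (nested_antichain nestedM pM p'M pp').
  exact/esym/(nested_antichain nestedM p'M pM pp').
rewrite -leq_subLR; apply: leq_trans (ML k p q pM qM pq).
by rewrite leq_sub2r // size_prefix.
Qed.

End NestedIndexSets.

Section FiniteType.
Variables (R : realType) (d m : nat) (F : simIFS R d m).
Variables (M : nat -> {fset seq 'I_m}) (O : set 'cV[R]_d).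
Hypotheses (d_gt0 : (0 < d)%N) (nestedM : nested_index_sets M).
Hypothesis finite_classes : finite_set (vertex_classes F M O).
Implicit Types (p q w : seq 'I_m).
Local Notation f := (word_map F).
Local Notation r := (word_ratio F).

Lemma pinv_word_mapK w : cancel ('pinv_(fun=> 0) setT (f w)) (f w).
Proof.
by move=> x; apply: (@pinvK _ _ (fun=> 0) setT); rewrite inE;
  have [y] := word_map_surj F w x; exists y.
Qed.

Lemma vertex_equiv_refl (v : vertex R d) : vertices F M v -> vertex_equiv F M O v v.
Proof.
move=> [k _ [w wM <-]]; have tr g : transfer (f w, k) (f w, k) \o g = g.
  by apply/funext => x; rewrite /transfer /= pinv_word_mapK.
split=> [|u u' _ _]; last by rewrite tr => ->.
by apply/seteqP; split=> _ [u uN <-]; exists u; rewrite ?tr.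
Qed.

(** The ratio of a similitude can be read off from how it moves 0 and a nonzero vector apart; such a
    vector exists because [0 < d]. *)
Lemma transfer_ratio p p0 q q0 k k0 :
  f q = transfer (f p0, k0) (f p, k) \o f q0 -> r q * r p0 = r p * r q0.
Proof.
move=> fq; pose x : 'cV[R]_d := const_mx 1.
have x0 : 0 < enorm (x - 0).
  rewrite lt_neqAle enorm_ge0 andbT eq_sym subr0; apply/eqP => /enorm_eq0/matrixP.
  by move=> /(_ (Ordinal d_gt0) 0)/eqP; rewrite !mxE oner_eq0.
apply/(mulIf (lt0r_neq0 x0)); rewrite mulrAC -enorm_word_map fq /transfer /= enorm_word_map.
by rewrite mulrAC -!mulrA -enorm_word_map !pinv_word_mapK enorm_word_map.
Qed.

Definition neighbor k p q := q \in M k /\ (f p @` O) `&` (f q @` O) !=set0.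

Lemma neighborhoodE k p : neighborhood F M O (f p, k) = [set (f q, k) | q in neighbor k p].
Proof.
apply/seteqP; split=> [_ [[q qM <-] pq]|_ [q [qM pq] <-]]; first by exists q.
by split=> //; exists q.
Qed.

(* No exact overlaps within a level: counting vertices is the same as counting words. *)
Hypothesis no_overlap : forall k p q, p \in M k -> q \in M k -> f p = f q -> p = q.

(** Equivalent vertices have neighbourhoods that correspond under the transfer map, which preserves
    ratios relative to the base vertex. So a bound at one representative holds on its whole class,
    and there are finitely many classes. *)
Lemma neighbors_bounded : exists b : nat, forall k p, p \in M k ->
  (forall s : seq (seq 'I_m), uniq s -> {in s, forall q, neighbor k p q} -> (size s <= b)%N) /\
  (forall q, neighbor k p q -> r q <= b%:R * r p).
Proof.
pose bounded (v : vertex R d) b := forall k p, v = (f p, k) -> p \in M k ->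
  (forall s : seq (seq 'I_m), uniq s -> {in s, forall q, neighbor k p q} -> (size s <= b)%N) /\
  (forall q, neighbor k p q -> r q <= b%:R * r p).
have bounded_mono (v : vertex R d) b b' : (b <= b')%N -> bounded v b -> bounded v b'.
  move=> bb' vb k p vE pM; have [sb rb] := vb k p vE pM; split=> [s us sP|q pq].
    exact: leq_trans (sb s us sP) bb'.
  by rewrite (le_trans (rb q pq)) // ler_wpM2r ?ler_nat // ltW ?word_ratio_gt0.
have [||b bP] := @finite_set_bound _ _ (fun (C : set (vertex R d)) b =>
  forall v, C v -> bounded v b) finite_classes.
- by move=> C b b' bb' Cb v /Cb; exact: bounded_mono.
- move=> _ [_ [k0 _ [p0 p0M <-]] <-].
  pose s0 := [seq q <- M k0 | `[< neighbor k0 p0 q >]].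
  (* The first entry counts the neighbours of the representative; the second bounds
     [r q / r p = r q0 / r p0], which is at most [(r p0)^-1]. *)
  exists (maxn (size s0) (Num.trunc (r p0)^-1).+1) => v [_ [N_eq _]] k p vE pM.
  rewrite vE in N_eq.
  have Q q : neighbor k p q -> exists2 q0, q0 \in s0 &
      f q = transfer (f p0, k0) (f p, k) \o f q0.
    move=> pq; have : [set u'.1 | u' in neighborhood F M O (f p, k)] (f q).
      by rewrite neighborhoodE; exists (f q, k) => //; exists q.
    rewrite N_eq neighborhoodE => -[_ [q0 pq0 <-] <-]; exists q0 => //.
    by rewrite mem_filter (asboolT pq0); case: pq0.
  split=> [s us sP|q pq].
    have {Q} /choice[h hP] : forall q, exists q0, q \in s ->
        q0 \in s0 /\ f q = transfer (f p0, k0) (f p, k) \o f q0.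
      move=> q; have [/sP/Q[q0 q0s fq]|] := boolP (q \in s); first by exists q0.
      by exists [::].
    (* [h] is injective on [s]: words with the same [q0] give the same map at level [k], so they
       coincide by [no_overlap]. *)
    apply: leq_trans (leq_maxl _ _); rewrite -(size_map h); apply: uniq_leq_size.
      rewrite map_inj_in_uniq // => q q' /[dup]/hP[_ fq] qs /[dup]/hP[_ fq'] q's hq.
      by apply: (no_overlap (sP q qs).1 (sP q' q's).1); rewrite fq fq' hq.
    by move=> _ /mapP[q /hP[] ? _ ->].
  have [q0 _ /transfer_ratio rq] := Q q pq.
  rewrite -(ler_pM2r (word_ratio_gt0 F p0)) rq mulrAC mulrC.
  rewrite ler_wpM2r ?(ltW (word_ratio_gt0 F _)) // (le_trans (word_ratio_le1 F _)) //.
  rewrite -ler_pdivrMr ?word_ratio_gt0 // div1r (le_trans (ltW (truncnS_gt _))) //.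
  by rewrite ler_nat leq_maxr.
exists b => k p pM; apply: (bP [set v' | vertices F M v' /\ vertex_equiv F M O (f p, k) v']
  _ (f p, k)) => //.
  by exists (f p, k) => //; exists k => //; exists p.
have pV : vertices F M (f p, k) by exists k => //; exists p.
by split=> //; exact: vertex_equiv_refl.
Qed.

End FiniteType.

(** * Bounded multiplicity and the open set *)

Section Multiplicity.
Variables (R : realType) (d m : nat) (F : simIFS R d m).
Variables (M : nat -> {fset seq 'I_m}) (O : set 'cV[R]_d).
Hypotheses (d_gt0 : (0 < d)%N) (nestedM : nested_index_sets M).
Hypothesis finite_classes : finite_set (vertex_classes F M O).
Hypothesis invariantO : invariant_open_set F O.
Local Notation f := (word_map F).
Local Notation r := (word_ratio F).
Hypothesis no_overlap : forall k p q, p \in M k -> q \in M k -> f p = f q -> p = q.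

Lemma invariant_ifs_map i : ifs_map F i @` O `<=` O.
Proof. by case: invariantO => _ _ _ FO x Ox; apply: FO; exists i. Qed.

(** At the last level [k] common to all words of [s], some [w] in [s] has not reached the next
    level, so its prefix [p] in [M k] has ratio comparable to [t]. Every [v] in [s] passes level [k]
    at a neighbour [q] of [p], since both images contain [z], and continues by a tail of bounded
    length. *)
Lemma cut_multiplicity : exists N : nat, forall t z (s : seq (seq 'I_m)), 0 < t <= 1 ->
  uniq s -> {in s, forall v, cut F t v /\ (f v @` O) z} -> (size s <= N)%N.
Proof.
have [b bP] := neighbors_bounded d_gt0 finite_classes no_overlap.
have [L LP] := index_gap nestedM.
have [c /andP[c0 c1] cP] := ratio_lower F.
have [rho rho1 rhoP] := ratio_upper F.
(* A tail [y] with ratio below this value would give [r v < c * (c ^+ L * r p) <= c * t],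
   contradicting [cut_lower]; [H] is thus the longest tail allowed. *)
have e0 : 0 < c ^+ L * c / b.+1%:R by rewrite divr_gt0 // mulr_gt0 // exprn_gt0.
have [H rhoH] := exprn_small rho1 e0; have /andP[rho_ge0 rho_lt1] := rho1.
have [W WP] := words_upto m H.
exists (b * size W)%N => t z s /andP[t0 t1] us sP.
have [->//|s0] := eqVneq s [::].
have [k [sk [w ws wk]]] := last_common_index nestedM s0.
have [p pM pw] := sk w ws.
have rp : c ^+ L * r p <= t.
  have [[wt _] _] := sP w ws; have := LP k p w pM pw wk.
  case/prefixP: pw wt => x ->; rewrite size_cat leq_add2l word_ratio_cat => + xL.
  apply: le_trans; rewrite mulrC ler_wpM2l ?(ltW (word_ratio_gt0 F _)) //.
  by apply: le_trans (cP x); rewrite ler_wiXn2l // ltW.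
have [nbr_size nbr_ratio] := bP k p pM.
pose qs := [seq q <- M k | `[< neighbor F M O k p q >]].
have qs_size : (size qs <= b)%N.
  apply: nbr_size => [|q]; first by rewrite filter_uniq // fset_uniq.
  by rewrite mem_filter => /andP[/asboolP].
apply: (@leq_trans (size [seq q ++ y | q <- qs, y <- W])); last first.
  by rewrite size_allpairs leq_mul2r qs_size orbT.
apply: uniq_leq_size => // v vs.
have [[_ vt] zv] := sP v vs; have [q qM qv] := sk v vs.
have pq : neighbor F M O k p q.
  split=> //; exists z; split.
    by apply: image_word_map_prefix pw _ (sP w ws).2; exact: invariant_ifs_map.
  by apply: image_word_map_prefix qv _ zv; exact: invariant_ifs_map.
have ctv : c * t <= r v.
  by apply: cut_lower (sP v vs).1; rewrite ?(ltW c0) ?(ltW t0) ?c1.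
case/prefixP: qv => y vE; apply/allpairsP; exists (q, y); split=> //=.
  by rewrite mem_filter qM andbT; exact/asboolP.
apply: WP; rewrite leqNgt; apply/negP => Hy.
suff : r v < c * t by rewrite ltNge ctv.
have ry : r y < c ^+ L * c / b.+1%:R.
  by apply: le_lt_trans rhoH; apply: le_trans (rhoP y) _;
    rewrite ler_wiXn2l ?(ltW Hy) ?(ltW rho_lt1) // ltnW.
have rq : r q <= b.+1%:R * r p.
  by rewrite (le_trans (nbr_ratio q pq)) // ler_wpM2r ?ler_nat // ltW ?word_ratio_gt0.
rewrite vE word_ratio_cat.
apply: (@le_lt_trans _ _ (b.+1%:R * r p * r y)).
  by rewrite ler_wpM2r // ltW ?word_ratio_gt0.
apply: (@lt_le_trans _ _ (b.+1%:R * r p * (c ^+ L * c / b.+1%:R))).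
  by rewrite ltr_pM2l // mulr_gt0 ?word_ratio_gt0.
have -> : b.+1%:R * r p * (c ^+ L * c / b.+1%:R) = c * (c ^+ L * r p).
  have : b.+1%:R != 0 :> R by rewrite pnatr_eq0.
  by move: (b.+1%:R) => B B0; field.
by rewrite ler_pM2l.
Qed.

Lemma open_image_word_map w : open O -> open (f w @` O).
Proof.
move=> oO; rewrite openE => _ [y Oy <-].
have [rho rho0 rhoP] := image_word_map_ball F oO Oy.
apply/nbhs_ballP; exists (rho * r w / d.+1%:R) => /= [|z].
  by rewrite divr_gt0 // mulr_gt0 // word_ratio_gt0.
rewrite -ball_normE /= distrC => zy; apply: rhoP.
apply: le_lt_trans (enorm_le_norm _) _; move: zy; rewrite ltr_pdivlMr //.
apply: le_lt_trans; rewrite mulrC ler_wpM2l // ler_nat //.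
Qed.

Lemma no_overlap_open_set_condition : open_set_condition F.
Proof.
have [Oneq Obd oO _] := invariantO; have FO := invariant_ifs_map.
have [N1 mult] := cut_multiplicity.
have [N bounded] := cut_neighbors_bounded Oneq oO Obd mult.
have [w sep] := separating_word FO bounded.
exists (\bigcup_k f (k ++ w) @` O); split.
- by case: Oneq => x Ox; exists (f w x), [::] => //; exists x.
- case: Obd => D [Dreal DP]; exists D; split=> // D' DD' _ [k _ [x Ox <-]].
  by apply: DP DD' _ _; exact: word_map_stable.
- by apply: bigcup_open => k _; exact: open_image_word_map.
- by move=> i _ [_ [k _ [x Ox <-]] <-]; exists (i :: k) => //; exists x.
move=> i j _ _ [z [[_ [k _ [x Ox <-]] xz] [_ [k' _ [x' Ox' <-]] xz']]].
apply: contrapT => /eqP ij.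
have zk : (f (i :: k ++ w) @` O) z by exists x.
have zk' : (f (j :: k' ++ w) @` O) z by exists x'.
(* [separating_word] only treats the case where the word without a prescribed ending has the smaller
   ratio, so the two words are ordered by ratio. *)
have [kk'|/ltW kk'] := leP (r (j :: k' ++ w)) (r (i :: k ++ w)).
  by have := sep i k j (k' ++ w) ij kk'; rewrite -subset0 => /(_ z); apply.
rewrite eq_sym in ij.
by have := sep j k' i (k ++ w) ij kk'; rewrite -subset0 => /(_ z); apply.
Qed.

End Multiplicity.
(** * Codings *)

Section Codings.
Variables (R : realType) (d m : nat) (F : simIFS R d m) (K : set 'cV[R]_d).
Hypothesis hK : self_similar_set F K.
Implicit Types (x y : 'cV[R]_d) (e : nat -> 'I_m).
Local Notation f := (word_map F).
Local Notation r := (word_ratio F).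

Lemma self_similar_stable i : ifs_map F i @` K `<=` K.
Proof. by case: hK => _ _ {2}-> x Kx; exists i. Qed.

Lemma self_similar_split n x : K x -> exists2 w, size w = n & (f w @` K) x.
Proof.
elim: n x => [|n IH] x Kx; first by exists [::] => //; exists x.
have [i _ [y /IH[w wn [z Kz <-]] <-]] : (\bigcup_i (ifs_map F i @` K)) x by case: hK => _ _ <-.
by exists (i :: w); rewrite /= ?wn //; exists z.
Qed.

Lemma image_prefix_mono e n n' : (n <= n')%N -> f (mkseq e n') @` K `<=` f (mkseq e n) @` K.
Proof.
move=> /subnKC <-; rewrite mkseqD; apply: image_word_map_cat; exact: self_similar_stable.
Qed.

Lemma closed_image_word_map w : closed (f w @` K).
Proof.
have [_ cK _] := hK; have clK := compact_closed (@norm_hausdorff _ _) cK.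
move=> x xcl; have [x' xE] := word_map_surj F w x; exists x' => //; apply: clK.
move=> B /nbhs_ballP[rho /= rho0 BB].
have /xcl[_ [[y Ky <-]]] : nbhs x (ball x (rho * r w / d.+1%:R)).
  by apply: nbhsx_ballx; rewrite divr_gt0 // mulr_gt0 ?word_ratio_gt0.
rewrite -ball_normE /= -xE ltr_pdivlMr // => xy; exists y; split=> //; apply: BB.
rewrite -ball_normE /=; apply: le_lt_trans (norm_le_enorm _) _.
rewrite -(ltr_pM2l (word_ratio_gt0 F w)) -enorm_word_map [ltRHS]mulrC.
apply: le_lt_trans (enorm_le_norm _) _; apply: le_lt_trans xy.
by rewrite mulrC ler_wpM2l // ler_nat.
Qed.

(** A cluster point of the images of one point of [K] lies in all the nested closed cylinders along
    [e]. *)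
Lemma exists_coded_point e : exists x, forall n, (f (mkseq e n) @` K) x.
Proof.
have [[x0 Kx0] cK _] := hK; pose u n := f (mkseq e n) x0.
have Ku k : K (u k) by apply: word_map_stable Kx0; exact: self_similar_stable.
have uK n : \forall k \near \oo, (f (mkseq e n) @` K) (u k).
  exists n => // k /= nk; apply: image_prefix_mono nk _ _.
  by exists x0.
have [|x [_ xcl]] := cK (u n @[n --> \oo]) _.
  by exists 0%N => [|k _]; [|exact: Ku].
exists x => n; apply: closed_image_word_map => B xB.
exact: xcl (uK n) xB.
Qed.

Lemma coding_of_images x e : (forall n, (f (mkseq e n) @` K) x) -> is_coding F x e.
Proof.
move=> xe; have [_ /compact_bounded/bounded_setP[D D0 KD] _] := hK.
have [rho rho1 rhoP] := ratio_upper F; have /andP[rho_ge0 rho_lt1] := rho1.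
apply/cvgrPdist_lt => eps eps0.
have C0 : 0 < d%:R * D + 1 by rewrite ltr_wpDl // mulr_ge0.
have [n rhon] := exprn_small rho1 (divr_gt0 eps0 C0).
exists n => // k /= nk; have [y Ky <-] := xe k.
apply: le_lt_trans (norm_le_enorm _) _; rewrite enorm_word_map subr0.
move: rhon; rewrite ltr_pdivlMr //; apply: le_lt_trans.
rewrite ler_pM ?enorm_ge0 ?(ltW (word_ratio_gt0 F _)) //.
  by rewrite (le_trans (rhoP _)) // size_mkseq ler_wiXn2l // ltW.
rewrite (le_trans (enorm_le_norm _)) // ler_wpDr // ler_wpM2l // KD //.
Qed.

(** Some point lies in all the cylinders of [e], and by uniqueness of limits it is the only point
    that [e] codes. *)
Lemma is_codingP x e : is_coding F x e <-> forall n, (f (mkseq e n) @` K) x.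
Proof.
split=> [xe|]; last exact: coding_of_images.
have [y ye] := exists_coded_point e.
suff -> : x = y by [].
have := coding_of_images ye; rewrite /is_coding in xe *.
exact: (cvg_unique (@norm_hausdorff _ _) xe).
Qed.

Lemma coding_cat w e x : is_coding F x e -> is_coding F (f w x) (cat_stream w e).
Proof.
move=> /is_codingP xe; apply/is_codingP => n.
apply: (@image_prefix_mono _ _ (size w + n)); first exact: leq_addl.
by rewrite mkseq_cat_stream; have [y Ky <-] := xe n; exists y; rewrite // word_map_cat.
Qed.

Lemma coding_shift n e x : is_coding F x e ->
  exists2 y, is_coding F y (fun i => e (n + i)%N) & f (mkseq e n) y = x.
Proof.
move=> /is_codingP xe; have [y Ky yx] := xe n; exists y => //; apply/is_codingP => k.
have [z Kz zx] := xe (n + k)%N; exists z => //.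
by apply: (@word_map_inj _ _ _ F (mkseq e n)); rewrite yx -zx mkseqD word_map_cat.
Qed.

End Codings.
(** * Upper bounds for the Hausdorff dimension *)

(** A list with repetitions, so that its sum of powers is exactly an [N]-th power, see
    [sum_block_words]. *)
Definition block_words (T : Type) (ws : seq (seq T)) (N : nat) : seq (seq T) :=
  iter N (fun l => [seq u ++ v | u <- ws, v <- l]) [:: [::]].

Lemma size_block_words (T : eqType) (ws : seq (seq T)) N v : [::] \notin ws ->
  v \in block_words ws N -> (N <= size v)%N.
Proof.
move=> ws0; elim: N v => // N IH _ /allpairsP[[u v] /= [uws /IH vN ->]].
rewrite size_cat -add1n leq_add // lt0n size_eq0.
by apply: contraNneq ws0 => <-.
Qed.

Lemma mkseq_block_words m (ws : seq (seq 'I_m)) n (e : nat -> 'I_m) N :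
  (forall k, mkseq (fun i => e (k + i)%N) n \in ws) -> mkseq e (N * n) \in block_words ws N.
Proof.
elim: N e => [|N IH] e ews; first by rewrite mul0n inE.
rewrite mulSn mkseqD; apply/allpairsP; exists (mkseq e n, mkseq (fun i => e (n + i)%N) (N * n)).
split=> //=; first exact: (ews 0%N).
by apply: IH => k; under eq_mkseq do rewrite addnA.
Qed.

Section HausdorffUpperBound.
Variables (R : realType) (d m : nat) (F : simIFS R d m).
Local Notation f := (word_map F).
Local Notation r := (word_ratio F).

Lemma diam_ge0 (A : set 'cV[R]_d) : A !=set0 -> (0 <= diam A)%E.
Proof.
move=> [x Ax]; apply: le_ereal_sup_tmp; exists (enorm (x - x))%:E;
  last by rewrite lee_fin enorm_ge0.
by exists (x, x).
Qed.

Lemma diam_pow_ge0 (t : R) (A : set 'cV[R]_d) : (0 <= diam_pow t A)%E.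
Proof. by rewrite /diam_pow; case: ifP => // _; exact: poweR_ge0. Qed.

Lemma hausdorff_measure_ge0 (t : R) (X : set 'cV[R]_d) : (0 <= hausdorff_measure t X)%E.
Proof.
apply: le_ereal_sup_tmp; exists (hausdorff_pre t 1 X); first by exists 1 => //=.
by apply: le_ereal_inf_tmp => _ [A _ <-]; apply: nneseries_ge0 => n _ _; exact: diam_pow_ge0.
Qed.

Lemma sum_block_words (ws : seq (seq 'I_m)) t N :
  \sum_(v <- block_words ws N) r v `^ t = (\sum_(u <- ws) r u `^ t) ^+ N.
Proof.
elim: N => [|N IH]; first by rewrite /= big_seq1 word_ratio_nil powR1.
rewrite [block_words _ _]/= big_allpairs_dep exprS -IH mulr_suml; apply: eq_bigr => u _.
rewrite mulr_sumr; apply: eq_bigr => v _.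
by rewrite word_ratio_cat powRM // ltW // word_ratio_gt0.
Qed.

Lemma hausdorff_measure_eq0 (K X : set 'cV[R]_d) (ws : seq (seq 'I_m)) t :
  bounded_set K -> 0 <= t -> [::] \notin ws -> \sum_(u <- ws) r u `^ t < 1 ->
  (forall N x, X x -> exists2 v, v \in block_words ws N & (f v @` K) x) ->
  hausdorff_measure t X = 0%E.
Proof.
move=> /bounded_setP[D0 D00 KD] t0 ws0 ws1 XP.
pose D := d%:R * (D0 + D0).
have D_ge0 : 0 <= D by rewrite mulr_ge0 // addr_ge0.
have KD' x y : K x -> K y -> enorm (x - y) <= D.
  move=> Kx Ky; rewrite (le_trans (enorm_le_norm _)) // ler_wpM2l //.
  by rewrite (le_trans (ler_normB _ _)) // lerD // KD.
have diamK v : (diam (f v @` K) <= (r v * D)%:E)%E.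
  apply: ge_ereal_sup => _ [[_ _] [[x Kx <-] [y Ky <-]] <-] /=.
  by rewrite lee_fin enorm_word_map ler_wpM2l ?KD' // ltW ?word_ratio_gt0.
have powK v : (diam_pow t (f v @` K) <= (r v `^ t * D `^ t)%:E)%E.
  rewrite /diam_pow; case: ifPn => [_|/set0P K0]; first by rewrite lee_fin mulr_ge0 // powR_ge0.
  rewrite -powRM ?(ltW (word_ratio_gt0 F _)) // -poweR_EFin.
  apply: gt0_ler_poweR => //; rewrite in_itv /= leey andbT; first exact: diam_ge0.
  by rewrite lee_fin mulr_ge0 // ltW ?word_ratio_gt0.
pose q := \sum_(u <- ws) r u `^ t.
have q1 : 0 <= q < 1 by rewrite sumr_ge0 // => u _; exact: powR_ge0.
have [rho rho1 rhoP] := ratio_upper F; have /andP[rho_ge0 rho_lt1] := rho1.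
apply/eqP; rewrite eq_le hausdorff_measure_ge0 andbT.
apply: ge_ereal_sup => _ [delta /= delta0 <-].
apply/lee_addgt0Pr => eps eps0; rewrite add0e.
have D1 : 0 < D + 1 by rewrite ltr_wpDl.
have Dt1 : 0 < D `^ t + 1 by rewrite ltr_wpDl // powR_ge0.
have [n1 n1P] := exprn_small rho1 (divr_gt0 delta0 D1).
have [n2 n2P] := exprn_small q1 (divr_gt0 eps0 Dt1).
pose N := maxn n1 n2; pose l := block_words ws N.
apply: ge_ereal_inf.
(* The finite cover is padded with empty sets, whose diameter is [-oo] and whose [diam_pow] is 0. *)
exists (\sum_(0 <= n <oo) diam_pow t (if (n < size l)%N then f (nth [::] l n) @` K else set0))%E.
  exists (fun n => if (n < size l)%N then f (nth [::] l n) @` K else set0) => //; split=> [x Xx|n].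
    have [v vl vx] := XP N x Xx; exists (index v l) => //=.
    by rewrite index_mem vl nth_index.
  case: ifPn => [nl|_]; last by rewrite /diam set0X image_set0 ereal_sup0 leNye.
  apply: le_trans (diamK _) _; rewrite lee_fin.
  move: n1P; rewrite ltr_pdivlMr // => /ltW; apply: le_trans.
  rewrite ler_pM ?(ltW (word_ratio_gt0 F _)) // ?lerDl //.
  apply: le_trans (rhoP _) _; rewrite ler_wiXn2l // 1?ltW //.
  by apply: leq_trans (leq_maxl n1 n2) _; apply: size_block_words ws0 _; exact: mem_nth.
rewrite (@nneseries_split _ _ 0 (size l)) => [|n _]; last exact: diam_pow_ge0.
rewrite eseries0 => [|n]; last by rewrite add0n ltnNge => -> _; rewrite /diam_pow eqxx.
rewrite adde0 add0n.
apply: (@le_trans _ _ (\sum_(0 <= n < size l) (r (nth [::] l n) `^ t * D `^ t)%:E)%E).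
  rewrite big_nat_cond [leRHS]big_nat_cond; apply: lee_sum => n /andP[/andP[_ ->] _].
  exact: powK.
rewrite -(big_nth [::] predT (fun v => (r v `^ t * D `^ t)%:E)) sumEFin lee_fin.
rewrite -mulr_suml sum_block_words -/q.
move: n2P; rewrite ltr_pdivlMr // => /ltW; apply: le_trans.
rewrite ler_pM ?powR_ge0 ?exprn_ge0 ?lerDl //; first by case/andP: q1.
by case/andP: q1 => q_ge0 /ltW q_le1; rewrite ler_wiXn2l // leq_maxr.
Qed.

End HausdorffUpperBound.

(** * The similarity dimension *)

Section SimilarityDimension.
Variables (R : realType) (d m : nat) (F : simIFS R d m).
Hypothesis m_gt0 : (0 < m)%N.
Local Notation r := (word_ratio F).

Lemma powR_ltr (a t t' : R) : 0 < a < 1 -> t < t' -> a `^ t' < a `^ t.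
Proof.
move=> /andP[a0 a1] tt'; rewrite /powR gt_eqF // ltr_expR ltr_nM2r //.
by rewrite ln_lt0 // a0.
Qed.

Lemma continuous_powR (a : R) : 0 < a -> continuous (fun t : R => a `^ t).
Proof.
move=> a0 t; rewrite /powR gt_eqF //.
apply: (@continuous_comp _ _ _ (fun t : R => t * ln a) (@expR R)).
  exact: mulrr_continuous.
exact: continuous_expR.
Qed.

Lemma continuous_sum_ratio (ws : seq (seq 'I_m)) :
  continuous (fun t : R => \sum_(u <- ws) r u `^ t).
Proof.
elim: ws => [|u ws IH].
  have -> : (fun t : R => \sum_(u <- [::]) r u `^ t) = cst 0 by apply/funext => t; exact: big_nil.
  by move=> t; exact: cst_continuous.
have -> : (fun t : R => \sum_(v <- u :: ws) r v `^ t) =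
    (fun t => r u `^ t) \+ (fun t => \sum_(v <- ws) r v `^ t).
  by apply/funext => t; rewrite /= big_cons.
move=> t; apply: continuousD; last exact: IH.
exact/continuous_powR/word_ratio_gt0.
Qed.

Definition letters := [seq [:: i] | i <- enum 'I_m].

Lemma sum_letters t : \sum_(u <- letters) r u `^ t = \sum_(i < m) ratio F i `^ t.
Proof.
by rewrite big_map big_enum /=; apply: eq_bigr => i _; rewrite /word_ratio big_seq1.
Qed.

Lemma sum_ratio_lt t t' : t < t' ->
  \sum_(i < m) ratio F i `^ t' < \sum_(i < m) ratio F i `^ t.
Proof.
move=> tt'; rewrite (bigD1 (Ordinal m_gt0)) // [ltRHS](bigD1 (Ordinal m_gt0)) //=.
rewrite ltr_leD ?powR_ltr ?ratio_itv //.
by apply: ler_sum => i _; rewrite ltW // powR_ltr ?ratio_itv.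
Qed.

Lemma sim_dimP : \sum_(i < m) ratio F i `^ sim_dim F = 1.
Proof.
apply: (@xgetPex _ 0 [set s : R | \sum_(i < m) ratio F i `^ s = 1]).
have [rho rho1 rhoP] := ratio_upper F.
have m_pos : 0 < (m%:R : R)^-1 by rewrite invr_gt0 ltr0n.
(* The sum is [m >= 1] at exponent 0 and at most [m * rho ^+ n <= 1] at [n], so the intermediate
   value theorem applies on this interval. *)
have [n /ltW nP] := exprn_small rho1 m_pos.
pose S (t : R) := \sum_(u <- letters) r u `^ t.
have S0 : 1 <= S 0.
  rewrite /S sum_letters (eq_bigr (fun=> 1)) => [|i _]; last by rewrite powRr0.
  by rewrite sumr_const card_ord ler1n.
have Sn : S n%:R <= 1.
  rewrite /S sum_letters; apply: (@le_trans _ _ (\sum_(i < m) (m%:R)^-1)).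
    apply: ler_sum => i _; rewrite powR_mulrn ?(ltW (ratio_gt0 F i)) //.
    apply: le_trans nP; rewrite lerXn2r ?nnegrE ?(ltW (ratio_gt0 F i)) //.
      by case/andP: rho1.
    by have := rhoP [:: i]; rewrite /word_ratio big_seq1 expr1.
  by rewrite sumr_const card_ord -[_ *+ m]mulr_natr mulVf // pnatr_eq0 -lt0n.
have [||s _ sP] := @IVT R S 0 n%:R 1 (ler0n _ _).
- exact/continuous_subspaceT/continuous_sum_ratio.
- by rewrite ge_min Sn orbT le_max S0.
by exists s; rewrite /= -sum_letters.
Qed.

Lemma lt_sim_dim t : (t < sim_dim F) = (1 < \sum_(i < m) ratio F i `^ t).
Proof.
have [ts|st|->] := ltgtP t (sim_dim F); rewrite -?sim_dimP ?ltxx //.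
  by rewrite sum_ratio_lt.
by apply/esym/negbTE; rewrite -leNgt ltW // sum_ratio_lt.
Qed.

Lemma gt_sim_dim t : (sim_dim F < t) = (\sum_(i < m) ratio F i `^ t < 1).
Proof.
have [ts|st|->] := ltgtP t (sim_dim F); rewrite -?sim_dimP ?ltxx //.
  by apply/esym/negbTE; rewrite -leNgt ltW // sum_ratio_lt.
by rewrite sum_ratio_lt.
Qed.

Lemma sim_dim_ge0 : 0 <= sim_dim F.
Proof.
rewrite leNgt gt_sim_dim -leNgt (eq_bigr (fun=> 1)) => [|i _]; last by rewrite powRr0.
by rewrite sumr_const card_ord ler1n.
Qed.

End SimilarityDimension.

(** * Upper bounds for the univoque set *)

Lemma mem_block_letters m (w : seq 'I_m) : w \in block_words (letters m) (size w).
Proof.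
elim: w => // i v IH.
by apply/allpairsP; exists ([:: i], v); rewrite /= map_f // mem_enum.
Qed.

Section UnivoqueUpperBound.
Variables (R : realType) (d m : nat) (F : simIFS R d m) (K : set 'cV[R]_d).
Hypotheses (m_gt0 : (0 < m)%N) (hK : self_similar_set F K).
Local Notation f := (word_map F).
Local Notation r := (word_ratio F).

Lemma self_similar_bounded : bounded_set K.
Proof. by case: hK => _ /compact_bounded. Qed.

Lemma hausdorff_dim_univoque_le : (hausdorff_dim (univoque_set F K) <= (sim_dim F)%:E)%E.
Proof.
apply/lee_addgt0Pr => eps eps0; apply: ge_ereal_inf.
exists (sim_dim F + eps)%:E => //; exists (sim_dim F + eps) => //; split.
  by rewrite addr_ge0 ?sim_dim_ge0 // ltW.
apply: (hausdorff_measure_eq0 (F := F) (ws := letters m) self_similar_bounded).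
- by rewrite addr_ge0 ?sim_dim_ge0 // ltW.
- by apply/mapP => -[].
- by rewrite sum_letters -gt_sim_dim // ltrDl.
move=> N x [_ [e [xe _]]]; exists (mkseq e (N * 1)).
  by apply: mkseq_block_words => k; apply/mapP; exists (e k); rewrite ?mem_enum // /mkseq /= addn0.
by move/(is_codingP hK): xe.
Qed.

(* Replacing one occurrence of [w] by [w'] in a coding would give a second coding. *)
Lemma univoque_avoids w w' x e : f w = f w' -> ~~ (prefix w w' || prefix w' w) ->
  univoque_set F K x -> is_coding F x e -> forall k, mkseq (fun i => e (k + i)%N) (size w) != w.
Proof.
move=> ww' incomp [_ [e0 [_ e0u]]] xe k; apply: contra incomp => /eqP gw.
pose g i := e (k + i)%N.
have [y yg xy] := coding_shift hK k xe.
have [z ze zy] := coding_shift hK (size w) yg.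
rewrite gw ww' in zy; pose e2 := cat_stream (mkseq e k) (cat_stream w' (fun i => g (size w + i)%N)).
have xe2 : is_coding F x e2 by rewrite -xy -zy; do 2 apply: (coding_cat hK).
(* By uniqueness [e] equals the altered coding, so it reads both [w] and [w'] at place [k], and one
   is a prefix of the other. *)
have ee2 : e = e2 by rewrite -(e0u _ xe) -(e0u _ xe2).
have gw' : mkseq g (size w') = w'.
  have := mkseq_cat_stream (mkseq e k) (cat_stream w' (fun i => g (size w + i)%N)) (size w' + 0).
  rewrite -/e2 -ee2 mkseq_cat_stream size_mkseq cats0 addn0 mkseqD => /eqP.
  by rewrite eqseq_cat // => /andP[_ /eqP].
rewrite -gw -gw' -/g.
have [le|/ltnW le] := leqP (size w) (size w').
  by rewrite -(subnKC le) mkseqD prefix_prefix.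
by rewrite -(subnKC le) mkseqD prefix_prefix orbT.
Qed.

(** Univoque codings use only blocks of length [n] other than [w]. At the similarity dimension the
    sum over all such blocks is 1, so without [w] it is below 1, and by continuity it stays so at
    some smaller [t]. *)
Lemma hausdorff_dim_overlap w w' : f w = f w' -> ~~ (prefix w w' || prefix w' w) ->
  (hausdorff_dim (univoque_set F K) < (sim_dim F)%:E)%E.
Proof.
move=> ww' incomp; pose n := size w; pose l := block_words (letters m) n.
pose ws := [seq u <- l | u != w].
have wl : w \in l by exact: mem_block_letters.
have n0 : w != [::] by apply: contraNneq incomp => ->; rewrite prefix0s.
(* Incomparable words require two letters; this leaves room for some [0 <= t] below the
   dimension. *)
have s_gt0 : 0 < sim_dim F.
  rewrite lt_sim_dim // (eq_bigr (fun=> 1)) => [|i _]; last by rewrite powRr0.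
  rewrite sumr_const card_ord ltr1n ltn_neqAle m_gt0 andbT eq_sym.
  apply: contra incomp => /eqP m1.
  have one (i j : 'I_m) : i = j by move: i j; rewrite m1 => i j; rewrite !ord1.
  elim: (w) (w') => [|i v IH] [|j v'] //.
  by rewrite !prefix_cons (one i j) eqxx IH.
pose S t := \sum_(u <- ws) r u `^ t.
have Ss : S (sim_dim F) < 1.
  have : \sum_(u <- l) r u `^ sim_dim F = 1.
    by rewrite sum_block_words sum_letters sim_dimP // expr1n.
  rewrite (bigID (pred1 w)) /= => <-; rewrite /S big_filter ltrDr (big_rem w) //= eqxx.
  by rewrite ltr_pwDl ?powR_gt0 ?word_ratio_gt0 // sumr_ge0 // => u _; exact: powR_ge0.
have [t /andP[t0 ts] St] : exists2 t, 0 <= t < sim_dim F & S t < 1.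
  have : \forall t \near sim_dim F, S t < 1.
    exact: (cvgr_lt _ (@continuous_sum_ratio _ _ _ F ws (sim_dim F))).
  move=> /nbhs_ballP[delta /= delta0 dP].
  pose h := Num.min delta (sim_dim F) / 2.
  have h0 : 0 < h by rewrite divr_gt0 // lt_min delta0.
  have hd : h < delta by rewrite /h ltr_pdivrMr // gt_min; apply/orP; left; lra.
  have hs : h < sim_dim F by rewrite /h ltr_pdivrMr // gt_min; apply/orP; right; lra.
  exists (sim_dim F - h); first by apply/andP; split; lra.
  by apply: dP; rewrite -ball_normE /= subKr gtr0_norm.
apply: (@le_lt_trans _ _ t%:E); last by rewrite lte_fin.
apply: ge_ereal_inf; exists t%:E => //; exists t => //; split=> //.
apply: (hausdorff_measure_eq0 (F := F) (ws := ws) self_similar_bounded) => //.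
  apply/negP; rewrite mem_filter => /andP[_ /size_block_words].
  have /[swap] /[apply] : [::] \notin letters m by apply/mapP => -[].
  by rewrite leqn0 size_eq0 (negbTE n0).
move=> N x Ux; have [_ [e [xe _]]] := Ux; exists (mkseq e (N * n)).
  apply: mkseq_block_words => k; rewrite mem_filter (univoque_avoids ww' incomp Ux xe) /=.
  by have := mem_block_letters (mkseq (fun i => e (k + i)%N) n); rewrite size_mkseq.
by move/(is_codingP hK): xe.
Qed.

End UnivoqueUpperBound.
(** * Lower bound under the open set condition *)

Lemma first_difference (T : eqType) (u v : seq T) : ~~ (prefix u v || prefix v u) ->
  exists a i j u' v', [/\ i != j, u = a ++ i :: u' & v = a ++ j :: v'].
Proof.
elim: u v => [|i u IH] [|j v] //.
have [<-|ij] := eqVneq i j; last by exists [::], i, j, u, v.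
by rewrite !prefix_cons eqxx /= => /IH[a [k [l [u' [v' [kl -> ->]]]]]];
  exists (i :: a), k, l, u', v'.
Qed.

Section Gap.
Variables (R : realType) (d m : nat) (F : simIFS R d m) (K : set 'cV[R]_d).
Hypotheses (m_gt0 : (0 < m)%N) (hK : self_similar_set F K).
Local Notation f := (word_map F).
Local Notation r := (word_ratio F).

(** Distinct words of one cut are incomparable, and at their first differing letters the images of
    [W] are disjoint. *)
Lemma open_set_cut_multiplicity (W : set 'cV[R]_d) : (forall i, ifs_map F i @` W `<=` W) ->
  trivIset setT (fun i => ifs_map F i @` W) ->
  forall t z (s : seq (seq 'I_m)), 0 < t <= 1 -> uniq s ->
     {in s, forall v, cut F t v /\ (f v @` W) z} -> (size s <= 1)%N.
Proof.
move=> FW dis t z [|u [|v s]] // _ /= /andP[]; rewrite inE negb_or => /andP[uv _] _ sP.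
have [[ut ucut] [x Wx xz]] := sP u (mem_head _ _).
have [[vt vcut] [y Wy yz]] : cut F t v /\ (f v @` W) z by apply: sP; rewrite !inE eqxx orbT.
have incomp a b : r a <= t -> (forall n, (n < size b)%N -> t < r (take n b)) -> a != b ->
    ~~ prefix a b.
  move=> at_ bt ab; apply: contra ab => /prefixP[[|l c] bE]; first by rewrite bE cats0.
  have := bt (size a); rewrite bE size_cat /= addnS ltnS leq_addr take_size_cat // => /(_ isT).
  by rewrite ltNge at_.
have [|a [i [j [u' [v' [ij uE vE]]]]]] := @first_difference _ u v.
  by rewrite negb_or !incomp // eq_sym.
move: xz; rewrite -yz uE vE !word_map_cat /= => /word_map_inj fij.
suff : i = j by move/eqP; rewrite (negbTE ij).
apply: (dis i j) => //; exists (ifs_map F i (f u' x)); split.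
  by exists (f u' x) => //; exact: word_map_stable.
by rewrite fij; exists (f v' y) => //; exact: word_map_stable.
Qed.

Definition unit_neighborhood : set 'cV[R]_d := [set x | exists2 y, K y & enorm (y - x) < 1].

Lemma unit_neighborhood_stable i : ifs_map F i @` unit_neighborhood `<=` unit_neighborhood.
Proof.
move=> _ [x [y Ky yx] <-]; exists (ifs_map F i y).
  by apply: (self_similar_stable hK (i := i)); exists y.
have /= -> := enorm_word_map F [:: i] y x.
rewrite /word_ratio big_seq1; apply: le_lt_trans yx.
by rewrite ler_piMl ?enorm_ge0 // ltW ?ratio_lt1.
Qed.

Lemma unit_neighborhood_bounded : bounded_set unit_neighborhood.
Proof.
have [D D0 KD] := bounded_setP (self_similar_bounded hK).
exists (D + 1); split; first exact: num_real.
move=> D' DD' x [y Ky yx]; apply: le_trans (ltW DD').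
have -> : x = y - (y - x) by rewrite subKr.
rewrite (le_trans (ler_normB _ _)) // lerD ?KD //.
exact: le_trans (norm_le_enorm _) (ltW yx).
Qed.

Lemma open_set_condition_gap : open_set_condition F -> exists w, forall l k l' x y, l != l' ->
  (f (l :: k ++ w) @` K) x -> (f [:: l'] @` K) y -> r (l :: k ++ w) <= enorm (x - y).
Proof.
move=> [W [Wneq Wbd oW FW dis]].
have mult := open_set_cut_multiplicity FW dis.
have [N bounded] := cut_neighbors_bounded Wneq oW unit_neighborhood_bounded mult.
have [w sep] := separating_word unit_neighborhood_stable bounded.
exists w => l k l' x y ll' [x' Kx' xE] [y' Ky' yE].
rewrite leNgt; apply/negP => xy.
have [rho rho1 rhoP] := ratio_upper F; have /andP[rho_ge0 rho_lt1] := rho1.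
have [n nP] := exprn_small rho1 (word_ratio_gt0 F (l :: k ++ w)).
(* The point [y] is put into a cylinder [l' :: j] deep enough for its ratio to be at most that of
   [l :: k ++ w]. *)
have [j jn [y2 Ky2 y2E]] := self_similar_split hK n Ky'.
have subB x0 : K x0 -> unit_neighborhood x0 by exists x0 => //; rewrite subrr enorm0.
have rj : r (l' :: j) <= r (l :: k ++ w).
  apply: le_trans (ltW nP); apply: le_trans (rhoP _) _.
  by rewrite ler_wiXn2l ?(ltW rho_lt1) //= jn.
have := sep l k l' j ll' rj; rewrite -subset0 => /(_ y); apply; split.
  by exists y2; [exact: subB|rewrite -yE -y2E].
have [y3 y3E] := word_map_surj F (l :: k ++ w) y; exists y3 => //; exists x' => //.
move: xy; rewrite -xE -y3E enorm_word_map gtr_pMr //; exact: word_ratio_gt0.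
Qed.

End Gap.

Section Univoque.
Variables (R : realType) (d m : nat) (F : simIFS R d m) (K : set 'cV[R]_d).
Hypothesis (hK : self_similar_set F K).
Local Notation f := (word_map F).
Local Notation r := (word_ratio F).
Variable w : seq 'I_m.
Hypothesis gap : forall l k l' x y, l != l' ->
  (f (l :: k ++ w) @` K) x -> (f [:: l'] @` K) y -> r (l :: k ++ w) <= enorm (x - y).

(** If a second coding first departs from [e] at [n], a later occurrence of [w] in [e] lets [gap]
    apply to the remaining tails: the point they share would have positive distance from itself. *)
Lemma univoque_of_recurrence e x : is_coding F x e ->
  (forall n, exists2 k, (n <= k)%N & mkseq (fun i => e (k + i)%N) (size w) = w) ->
  univoque_set F K x.
Proof.
move=> xe ew; split.
  by have /(is_codingP hK)/(_ 0%N)[y Ky <-] := xe.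
exists e; split=> // e' xe'; apply: contrapT => /eqP ee'.
have ex : exists n, e n != e' n.
  apply: contrapT => noN; move/eqP: ee'; apply; apply/funext => n; apply/eqP.
  by apply: contrapT => /negP en; apply: noN; exists n.
case: (ex_minnP ex) => n en nmin.
have ee'n : mkseq e n = mkseq e' n.
  apply/eq_in_map => i; rewrite mem_iota /= => ilt; apply/eqP.
  by apply: contraTT ilt => /nmin; rewrite -leqNgt.
have [y yg xy] := coding_shift hK n xe; have [y' yg' xy'] := coding_shift hK n xe'.
have yy' : y = y' by apply: (@word_map_inj _ _ _ F (mkseq e n)); rewrite xy ee'n xy'.
have [p np pw] := ew n.+1.
have pn : (p = n + (p - n.+1).+1)%N by rewrite addnS -addSn subnKC.
have /(is_codingP hK)/(_ ((p - n.+1).+1 + size w)%N) := yg.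
rewrite mkseqD; have -> : mkseq (fun i => e (n + ((p - n.+1).+1 + i))%N) (size w) = w.
  by rewrite -[RHS]pw; apply: eq_mkseq => i; rewrite [in RHS]pn addnA.
rewrite {1}/mkseq [iota _ _]/= map_cons addn0 => yK.
have /(is_codingP hK)/(_ 1%N) := yg'; rewrite /mkseq /= addn0 -yy' => yK'.
have := gap en yK yK'; rewrite subrr enorm0 leNgt => /negP; apply; exact: word_ratio_gt0.
Qed.

End Univoque.

(** * A Kraft inequality for infinitely many cylinders *)

Section Kraft.
Variables (R : realType) (T : finType) (p : T -> R).
Hypotheses (p_gt0 : forall a, 0 < p a) (p_sum : 1 <= \sum_a p a).

Definition weight (s : seq T) : R := \prod_(a <- s) p a.

Lemma weight_gt0 s : 0 < weight s.
Proof. exact: prodr_gt0. Qed.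

(* Greedy choice of the letters of [c]: the cylinders below a good word weigh less than it. *)
Lemma kraft (V : nat -> option (seq T)) :
  (\sum_(0 <= j <oo) (oapp weight 0 (V j))%:E < 1)%E ->
  exists c : nat -> T, forall j v, V j = Some v -> v <> mkseq c (size v).
Proof.
pose term u j := oapp (fun v => if prefix u v then weight v else 0) 0 (V j).
have term_ge0 u j : (0 <= (term u j)%:E)%E.
  by rewrite lee_fin /term; case: (V j) => //= v; case: ifP => // _; exact/ltW/weight_gt0.
pose S u := (\sum_(0 <= j <oo) (term u j)%:E)%E.
pose good u := (S u < (weight u)%:E)%E => V1.
have good0 : good [::].
  rewrite /good /weight big_nil; apply: le_lt_trans V1.
  by apply: lee_nneseries => // j _; rewrite lee_fin /term; case: (V j) => //= v; rewrite prefix0s.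
have step u : good u -> exists a, good (rcons u a).
  move=> gu; apply: contrapT => bad; move: gu; apply/negP; rewrite -leNgt.
  apply: (@le_trans _ _ (\sum_a (weight (rcons u a))%:E)%E).
    rewrite sumEFin lee_fin; under eq_bigr => a _ do rewrite /weight big_rcons /=.
    by rewrite -mulr_sumr ler_peMr // ltW // weight_gt0.
  apply: (@le_trans _ _ (\sum_a S (rcons u a))%E).
    by apply: lee_sum => a _; rewrite leNgt; apply/negP => ga; apply: bad; exists a.
  rewrite -nneseries_sum //; apply: lee_nneseries => [j _ _|j _]; first exact: sume_ge0.
  rewrite sumEFin lee_fin /term; case: (V j) => [v|] /=; last by rewrite big1.
  (* A word properly extending [u] lies below exactly one child of [u], and [u] itself below none,
     so the children together collect at most [S u]. *)
  case: (boolP [exists a, prefix (rcons u a) v]) => [/existsP[a av]|/existsPn noa].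
    have -> : prefix u v by apply: prefix_trans av; exact: prefix_rcons.
    rewrite (bigD1 a) //= av big1 ?addr0 // => b ba; case: ifP => // bv.
    move: av bv; rewrite !prefixE !size_rcons => /eqP-> /eqP/rcons_inj[ab].
    by rewrite ab eqxx in ba.
  rewrite big1 => [|a _]; last by rewrite (negbTE (noa a)).
  by case: ifP => // _; exact/ltW/weight_gt0.
have /choice[h hP] : forall u, exists a, good u -> good (rcons u a).
  move=> u; have [/step[a ga]|nu] := pselect (good u); first by exists a.
  have [a _|T0] := pickP T; first by exists a.
  by move: p_sum; rewrite big_pred0 // ler10.
pose us n := iter n (fun u => rcons u (h u)) [::].
have usE n : mkseq (fun n => h (us n)) n = us n.
  by elim: n => // n IH; rewrite mkseqS IH.
exists (fun n => h (us n)) => j v Vj vE.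
(* If [V j] were a prefix of the stream it would be good, yet its own term already contributes its
   full weight. *)
have : good v by rewrite vE usE; elim: (size v) => //= n; exact: hP.
rewrite /good ltNge => /negP; apply.
apply: le_trans (nneseries_lim_ge j.+1 (fun n _ _ => term_ge0 v n)).
rewrite big_nat_recr //= {2}/term Vj /= prefix_refl leeDr //.
exact: sume_ge0.
Qed.

End Kraft.

Lemma sum_tuple_prod (R : realType) (T : finType) (g : T -> R) n :
  \sum_(u : n.-tuple T) \prod_(i <- u) g i = (\sum_i g i) ^+ n.
Proof.
rewrite -[in RHS](card_ord n) -prodr_const bigA_distr_bigA /=.
rewrite (reindex (@tuple_of_finfun T n)) /=; last first.
  by exists (@finfun_of_tuple T n) => u _; rewrite ?tuple_of_finfunK ?finfun_of_tupleK.
by apply: eq_bigr => u _; rewrite big_map big_enum.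
Qed.

(** * Positive measure of the univoque set *)

Section LowerBound.
Variables (R : realType) (d m : nat) (F : simIFS R d m) (K : set 'cV[R]_d).
Hypotheses (m_gt0 : (0 < m)%N) (hK : self_similar_set F K).
Local Notation f := (word_map F).
Local Notation r := (word_ratio F).
Variable w : seq 'I_m.
Hypothesis gap : forall l k l' x y, l != l' ->
  (f (l :: k ++ w) @` K) x -> (f [:: l'] @` K) y -> r (l :: k ++ w) <= enorm (x - y).
Variable n : nat.
Local Notation T := (n.+1.-tuple 'I_m).

(** The final [w] makes it recur in every stream of blocks and lets [gap] act inside each block; the
    length [n.+1] keeps [q] positive even for empty [w]. *)
Definition block (u : T) : seq 'I_m := u ++ w.
Local Notation q := (n.+1 + size w)%N.
Definition block_stream (c : nat -> T) (i : nat) : 'I_m :=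
  nth (Ordinal m_gt0) (block (c (i %/ q)%N)) (i %% q).

Lemma size_block u : size (block u) = q.
Proof. by rewrite size_cat size_tuple. Qed.

Lemma block_streamE c j : mkseq (fun i => block_stream c (j * q + i)) q = block (c j).
Proof.
apply: (@eq_from_nth _ (Ordinal m_gt0)) => [|i]; rewrite size_mkseq ?size_block // => iq.
by rewrite nth_mkseq // /block_stream divnMDl // divn_small // addn0 modnMDl modn_small.
Qed.

Lemma block_stream_prefix c N :
  mkseq (block_stream c) (N * q) = flatten (map block (mkseq c N)).
Proof.
elim: N => [|N IH]; first by rewrite mul0n.
by rewrite mulSnr mkseqD IH block_streamE mkseqS map_rcons flatten_rcons.
Qed.

Lemma block_stream_univoque c x : is_coding F x (block_stream c) -> univoque_set F K x.
Proof.
move=> xc; apply: (univoque_of_recurrence hK gap xc) => N.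
exists (N * q + n.+1)%N; first by rewrite mulnDr mulnS -!addnA leq_addr.
have := block_streamE c N; rewrite mkseqD /block => /eqP.
rewrite eqseq_cat ?size_mkseq ?size_tuple // => /andP[_ /eqP wE].
by rewrite -[RHS]wE; apply: eq_mkseq => i; rewrite addnA.
Qed.

(** The common blocks scale the distance. In the next block the [u] parts have equal length, so they
    differ at some letter, and what follows it ends in [w] as [gap] demands. *)
Lemma block_gap gamma c c' N x x' : (forall u, gamma <= r (block u)) ->
  is_coding F x (block_stream c) -> is_coding F x' (block_stream c') ->
  mkseq c N = mkseq c' N -> c N != c' N ->
  r (flatten (map block (mkseq c N))) * gamma <= enorm (x - x').
Proof.
move=> gammaP xc xc' cc' cN.
have [y yc <-] := coding_shift hK (N * q) xc; have [y' yc' <-] := coding_shift hK (N * q) xc'.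
rewrite !block_stream_prefix -cc' enorm_word_map ler_wpM2l ?(ltW (word_ratio_gt0 F _)) //.
have /(is_codingP hK)/(_ q) := yc; have /(is_codingP hK)/(_ q) := yc'.
rewrite !block_streamE => -[z' Kz' <-] [z Kz <-]; apply: le_trans (gammaP (c N)) _.
have [|a [l [l' [u [u' [ll' cE c'E]]]]]] := @first_difference _ (c N) (c' N).
  apply: contra cN; rewrite !prefixE !size_tuple !take_oversize ?size_tuple //.
  by case/orP => /eqP cc; apply/eqP/val_inj.
rewrite /block cE c'E -!catA !cat_cons !word_map_cat enorm_word_map word_ratio_cat.
rewrite ler_wpM2l ?(ltW (word_ratio_gt0 F _)) //; apply: (gap ll'); first by exists z.
apply: (image_word_map_cat (u := [:: l']) (v := u' ++ w)) => [i|]; first exact: self_similar_stable.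
by exists z'.
Qed.

Variable t : R.
Hypotheses (t_ge0 : 0 <= t) (sum_ge1 : 1 <= \sum_(u : T) r (block u) `^ t).

Lemma weight_block (s : seq T) :
  weight (fun u => r (block u) `^ t) s = r (flatten (map block s)) `^ t.
Proof.
elim: s => [|u s IH] /=; first by rewrite /weight big_nil word_ratio_nil powR1.
rewrite /weight big_cons -/(weight _ s) IH word_ratio_cat powRM //;
exact/ltW/word_ratio_gt0.
Qed.

Lemma weight_block_small c (eta : R) : 0 < t -> 0 < eta ->
  exists N, weight (fun u => r (block u) `^ t) (mkseq c N) <= eta.
Proof.
move=> t0 eta0; have [rho rho1 rhoP] := ratio_upper F; have /andP[rho_ge0 rho_lt1] := rho1.
have [N NP] := exprn_small rho1 (powR_gt0 t^-1 eta0); exists N.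
have -> : eta = (eta `^ t^-1) `^ t.
  by rewrite -powRrM mulVf ?gt_eqF // powRr1 // ltW.
rewrite weight_block ge0_ler_powR ?nnegrE ?powR_ge0 ?(ltW (word_ratio_gt0 F _)) //.
apply: le_trans (ltW NP); apply: le_trans (rhoP _) _; rewrite ler_wiXn2l // 1?ltW //.
by rewrite -block_stream_prefix size_mkseq leq_pmulr.
Qed.

(* One cylinder contains the codings of all points of [A], and its weight is controlled by
   the diameter of [A]; the slack [eta] serves the sets [A] of diameter 0. *)
Lemma covering_cylinder gamma (A : set 'cV[R]_d) (eta : R) : 0 < gamma ->
  (forall u, gamma <= r (block u)) -> (diam A <= 1%:E)%E -> 0 < eta ->
  exists V : option (seq T),
    ((oapp (weight (fun u => r (block u) `^ t)) 0 V)%:E <=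
       (gamma^-1 `^ t)%:E * diam_pow t A + eta%:E)%E /\
    forall c x, is_coding F x (block_stream c) -> A x ->
      exists2 v, V = Some v & v = mkseq c (size v).
Proof.
move=> gamma0 gammaP A1 eta0.
have C_ge0 : (0 <= (gamma^-1 `^ t)%:E * diam_pow t A)%E.
  by rewrite mule_ge0 ?diam_pow_ge0 // lee_fin powR_ge0.
have [[c0 [x0 [xc0 Ax0]]]|noc] :=
  pselect (exists c x, is_coding F x (block_stream c) /\ A x); last first.
  exists None; split; first by rewrite /= adde_ge0 // lee_fin ltW.
  by move=> c x xc Ax; case: noc; exists c, x.
have A0 : A !=set0 by exists x0.
have An0 : A != set0 by apply/set0P.
pose P N := `[< exists c x, [/\ is_coding F x (block_stream c), A x & mkseq c0 N != mkseq c N] >].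
have [exP|noP] := pselect (exists N, P N); last first.
  have agree N c x : is_coding F x (block_stream c) -> A x -> mkseq c0 N = mkseq c N.
    move=> xc Ax; apply/eqP; apply: contrapT => /negP cN; apply: noP; exists N.
    by apply/asboolP; exists c, x.
  (* Here all block codings of points of [A] agree. At [t = 0] the empty word, of weight 1, is paid
     for by [diam_pow], since [A] is nonempty; for [t > 0] a long cylinder weighs at most [eta]. *)
  move: t_ge0; rewrite le_eqVlt => /predU1P[t0|t0].
    exists (Some [::]); split=> [|c x _ _]; last by exists [::].
    rewrite /= /weight big_nil -t0 powRr0 mul1e /diam_pow (negbTE An0) poweRe0.
    by rewrite -EFinD lee_fin lerDl ltW.
  have [N NP] := weight_block_small c0 t0 eta0.
  exists (Some (mkseq c0 N)); split=> [|c x xc Ax].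
    by rewrite -[leLHS]add0e leeD // lee_fin.
  by exists (mkseq c0 N); rewrite // size_mkseq; exact: agree xc Ax.
(* [N] blocks are shared by all codings, and [c0], [c1] differ at block [N]; [block_gap] then bounds
   the diameter from below. *)
case: (ex_minnP exP) => -[|N] /asboolP[c1 [x1 [xc1 Ax1]]] // cN Nmin.
have agree c x : is_coding F x (block_stream c) -> A x -> mkseq c0 N = mkseq c N.
  move=> xc Ax; apply/eqP; apply: contrapT => /negP cN'.
  suff /Nmin : P N by rewrite ltnn.
  by apply/asboolP; exists c, x.
exists (Some (mkseq c0 N)); split=> [|c x xc Ax]; last first.
  by exists (mkseq c0 N); rewrite // size_mkseq; exact: agree xc Ax.
have c01 := agree _ _ xc1 Ax1.
have c01N : c0 N != c1 N by move: cN; rewrite !mkseqS c01; apply: contraNneq => ->.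
have gap01 := block_gap gammaP xc0 xc1 c01 c01N.
have diam_ge : ((enorm (x0 - x1))%:E <= diam A)%E.
  by apply: ereal_sup_ubound; exists (x0, x1).
have diam_fin : diam A \is a fin_num.
  by rewrite ge0_fin_numE ?diam_ge0 // (le_lt_trans A1) // ltry.
rewrite /diam_pow (negbTE An0) /= weight_block.
move: diam_ge; rewrite -(fineK diam_fin) lee_fin poweR_EFin -EFinM -EFinD lee_fin => diam_ge.
have D0 : 0 <= fine (diam A) by apply: le_trans diam_ge; exact: enorm_ge0.
rewrite -powRM ?invr_ge0 ?(ltW gamma0) // ler_wpDr ?(ltW eta0) //.
rewrite ge0_ler_powR ?nnegrE ?(ltW (word_ratio_gt0 F _)) ?mulr_ge0 ?invr_ge0 ?(ltW gamma0) //.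
by rewrite mulrC ler_pdivlMr // (le_trans gap01).
Qed.

(** A cover with too small a sum would yield cylinders of total weight below 1. By [kraft] some
    stream of blocks avoids them all, although the point it codes is univoque and hence covered. *)
Lemma hausdorff_measure_univoque_gt0 : (0 < hausdorff_measure t (univoque_set F K))%E.
Proof.
have [c /andP[c0 c1] cP] := ratio_lower F.
pose gamma := c ^+ q; have gamma0 : 0 < gamma by rewrite exprn_gt0.
have gammaP u : gamma <= r (block u) by rewrite /gamma -(size_block u).
pose C := gamma^-1 `^ t; have C0 : 0 < C by rewrite powR_gt0 // invr_gt0.
pose wt := weight (fun u : T => r (block u) `^ t).
apply: (@lt_le_trans _ _ (2 * C)^-1%:E); first by rewrite lte_fin invr_gt0 mulr_gt0.
apply: le_ereal_sup_tmp; exists (hausdorff_pre t 1 (univoque_set F K)); first by exists 1 => //=.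
apply: le_ereal_inf_tmp => _ [A [UA A1] <-].
(* The slacks add up to 1/2, and a sum below [(2 * C)^-1] contributes less than the other half. *)
have eta0 j : 0 < 2^-1 / (2 ^ j.+1)%:R :> R by rewrite divr_gt0 ?invr_gt0 // ltr0n expn_gt0.
have /choice[V VP] j := covering_cylinder gamma0 gammaP (A1 j) (eta0 j).
rewrite leNgt; apply/negP => sumA.
have wt_ge0 v : 0 <= wt v by apply/ltW/weight_gt0 => u; rewrite powR_gt0 ?word_ratio_gt0.
have sumV : (\sum_(0 <= j <oo) (oapp wt 0 (V j))%:E < 1)%E.
  apply: (@le_lt_trans _ _ (\sum_(0 <= j <oo)
      (C%:E * diam_pow t (A j) + (2^-1 / (2 ^ j.+1)%:R)%:E))%E).
    apply: lee_nneseries => [j _ _|j _]; last by case: (VP j).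
    by rewrite lee_fin; case: (V j) => /=.
  apply: le_lt_trans (epsilon_trick xpredT _ _) _ => [j||].
  - by rewrite mule_ge0 ?diam_pow_ge0 // lee_fin ltW.
  - by rewrite invr_ge0.
  rewrite nneseriesZl => [|j _]; last exact: diam_pow_ge0.
  have -> : 1%E = ((2^-1)%:E + (2^-1)%:E)%E :> \bar R by rewrite -EFinD; congr EFin; lra.
  rewrite lteD2rE //.
  have -> : (2^-1)%:E = (C%:E * ((2 * C)^-1)%:E)%E :> \bar R.
    by rewrite -EFinM invfM mulrCA divff ?mulr1 // gt_eqF.
  by rewrite lte_pmul2l.
have [u||e eP] := kraft _ _ sumV; [by rewrite powR_gt0 ?word_ratio_gt0|by []|].
have [x /(is_codingP hK) xe] := exists_coded_point hK (block_stream e).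
have [j _ Ajx] := UA _ (block_stream_univoque xe).
have [v Vj vE] := (VP j).2 e x xe Ajx.
exact: eP Vj vE.
Qed.

End LowerBound.

Lemma open_set_condition_hausdorff_measure_gt0 (R : realType) (d m : nat) (F : simIFS R d m)
    (K : set 'cV[R]_d) (t : R) : (0 < m)%N -> self_similar_set F K -> open_set_condition F ->
  0 <= t < sim_dim F -> (0 < hausdorff_measure t (univoque_set F K))%E.
Proof.
move=> m_gt0 hK /(open_set_condition_gap hK)[w gap] /andP[t0]; rewrite lt_sim_dim //.
set b := \sum_(i < m) _ => b1; have b0 : 0 < b by apply: lt_trans b1.
have [|n nP] := @exprn_small _ b^-1 (word_ratio F w `^ t) _ (powR_gt0 t (word_ratio_gt0 F w)).
  by rewrite invr_ge0 (ltW b0) invf_lt1.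
apply: (@hausdorff_measure_univoque_gt0 _ _ _ F K m_gt0 hK w gap n) => //.
have -> : \sum_(u : n.+1.-tuple 'I_m) word_ratio F (block w u) `^ t =
    b ^+ n.+1 * word_ratio F w `^ t.
  rewrite /b -sum_tuple_prod mulr_suml; apply: eq_bigr => u _.
  rewrite /block word_ratio_cat powRM ?(ltW (word_ratio_gt0 F _)) //; congr (_ * _).
  elim: (tval u) => [|i v IH]; first by rewrite word_ratio_nil powR1 big_nil.
  rewrite /word_ratio !big_cons powRM ?(ltW (ratio_gt0 F _)) -?IH //.
  exact/ltW/(word_ratio_gt0 F v).
have bn0 : 0 < b ^+ n.+1 by rewrite exprn_gt0.
rewrite -ler_pdivrMl // mulr1 (le_trans _ (ltW nP)) // exprVn lef_pV2 ?posrE ?exprn_gt0 //.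
by rewrite exprS ler_peMl ?ltW // exprn_gt0.
Qed.

Theorem theorem1p3 (R : realType) (d m : nat) (hd : (1 <= d)%N)
    (hm : (1 <= m)%N) (F : simIFS R d m) (K : set 'cV[R]_d)
    (hK : self_similar_set F K) (hF : general_finite_type F) :
  open_set_condition F <->
  hausdorff_dim (univoque_set F K) = ((sim_dim F)%:E)%E.
Proof.
split=> [osc|dimU].
  apply/eqP; rewrite eq_le hausdorff_dim_univoque_le //=.
  apply: le_ereal_inf_tmp => _ [t [t0 Ht] <-]; rewrite lee_fin leNgt; apply/negP => ts.
  have := @open_set_condition_hausdorff_measure_gt0 _ _ _ F K t hm hK osc.
  by rewrite t0 ts Ht ltxx => /(_ isT).
have [M [G [nestedM invG fin_classes]]] := hF.
apply: (no_overlap_open_set_condition hd nestedM fin_classes invG) => k p q pM qM fpq.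
apply: contrapT => pq.
(* Distinct words of [M k] are incomparable, so an exact overlap would lower the dimension. *)
suff : (hausdorff_dim (univoque_set F K) < (sim_dim F)%:E)%E by rewrite dimU ltxx.
apply: (hausdorff_dim_overlap hm hK fpq); apply/negP => /orP[pre|pre].
  by apply: pq; exact: (nested_antichain nestedM pM qM pre).
by apply: pq; exact/esym/(nested_antichain nestedM qM pM pre).
Qed.
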